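(* Let $\mathcal{N}(t)$, $t>0$, be a classical nonlinear pure birth process with pairwise distinct birth rates $\lambda_k>0$, $k\ge1$, and $\mathcal{N}(0)=1$. Let $n\in\mathbb{N}$, $n\ge1$, and let $T^1_t,\dots,T^n_t$ be the first-passage times at level $t$ of $n$ independent standard Brownian motions, independent of $\mathcal{N}$. The process $$\tilde{\mathcal{N}}(t)=\mathcal{N}\Bigl(T^1_{T^2_{\cdots_{T^n_t}}}\Bigr),\qquad t>0,$$ has state probabilities $\tilde p_k(t)=\Pr\{\tilde{\mathcal{N}}(t)=k\}$ given by $$\tilde p_k(t)=\begin{cases}\displaystyle\prod_{j=1}^{k-1}\lambda_j\sum_{m=1}^k\frac{\exp\bigl(-t\,\lambda_m^{1/2^n}\,2^{1-1/2^n}\bigr)}{\prod_{l=1,l\neq m}^k(\lambda_l-\lambda_m)},&k>1,\ t>0,\\[2mm]\exp\bigl(-t\,\lambda_1^{1/2^n}\,2^{1-1/2^n}\bigr),&k=1,\ t>0.\end{cases}$$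
   Context: The nonlinear pure birth process $\mathcal{N}(t)$ with rates $(\lambda_k)_{k\ge1}$ is the continuous-time Markov chain on $\{1,2,\dots\}$ started at $1$ which from state $k$ jumps only to $k+1$, at rate $\lambda_k$; it is assumed throughout that $\sum_k1/\lambda_k=\infty$ (no explosion). For independent standard Brownian motions $B^1,\dots,B^n$, $T^j_x=\inf\{s:B^j(s)=x\}$, $x>0$; the iterated time is obtained by evaluating $T^n$ at $t$, then $T^{n-1}$ at the level $T^n_t$, and so on up to $T^1$. *)

(* Defs.v *)
From HB Require Import structures.
From mathcomp Require Import all_boot all_order all_algebra.
From mathcomp Require Import all_classical all_reals all_analysis.

Set Implicit Arguments.
Unset Strict Implicit.
Unset Printing Implicit Defensive.

Import Order.TTheory GRing.Theory Num.Theory.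
Import numFieldNormedType.Exports.

Local Open Scope classical_set_scope.
Local Open Scope ring_scope.

(* Processes have time set [0, +oo[; the index type is R, and the values at
   negative times are unconstrained and never used. *)

Definition process_sigma_algebra d d' (T : measurableType d)
    (S : measurableType d') (R : realType) (D : set R) (X : R -> T -> S) :
    set (set T) :=
  <<s \bigcup_(u in D) preimage_set_system setT (X u) measurable >>.

Definition mutually_independent d (T : measurableType d) (R : realType)
    (P : probability T R) (I : finType) (F : I -> set (set T)) : Prop :=
  forall (J : {set I}) (A : I -> set T), (forall i, i \in J -> F i (A i)) ->
    P (\bigcap_(i in [set` J]) A i) = (\prod_(i in J) P (A i))%E.

Definition independent_processes d d' (T : measurableType d)
    (S : measurableType d') (R : realType) (P : probability T R) (n : nat)
    (N : R -> T -> S) (B : 'I_n -> R -> T -> R) : Prop :=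
  mutually_independent P (fun o : option 'I_n =>
    if o is Some j then process_sigma_algebra `[0, +oo[ (B j)
    else process_sigma_algebra `[0, +oo[ N).

(* The second parameter of [normal_prob] is the standard deviation. *)
Record standard_brownian_motion d (T : measurableType d) (R : realType)
    (P : probability T R) (B : R -> {RV P >-> R}) : Prop := {
  bm_start : forall w, B 0 w = 0;
  bm_continuous : forall w, {within `[0, +oo[, continuous (fun t : R => B t w)};
  bm_increment_normal : forall (s t : R) (Y : set R),
    0 <= s -> s < t -> measurable Y ->
    P [set w | Y (B t w - B s w)] = normal_prob 0 (Num.sqrt (t - s)) Y;
  bm_increment_indep : forall (s t : R) (A : set T) (Y : set R),
    0 <= s -> s < t -> process_sigma_algebra `[0, s] B A -> measurable Y ->
    P (A `&` [set w | Y (B t w - B s w)]) =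
      (P A * P [set w | Y (B t w - B s w)%R])%E
}.

Arguments standard_brownian_motion {d T R} P B.

(* Time-homogeneous Markov property with state space {1, 2, ...}, written as a
   product so that nothing is conditioned on a null event; p h i j is the
   probability of moving from i to j in time h. *)
Record markov_chain_with_transition d (T : measurableType d) (R : realType)
    (P : probability T R) (X : R -> {RV P >-> nat}) (p : R -> nat -> nat -> R) :
    Prop := {
  mc_state : forall (t : R) (w : T), 0 <= t -> (0 < X t w)%N;
  mc_transition_ge0 : forall (h : R) (i j : nat),
    0 <= h -> (0 < i)%N -> (0 < j)%N -> 0 <= p h i j;
  mc_transition_sum1 : forall (h : R) (i : nat), 0 <= h -> (0 < i)%N ->
    (\sum_(1 <= j <oo) (p h i j)%:E = 1)%E;
  mc_markov : forall (s h : R) (i j : nat) (A : set T),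
    0 <= s -> 0 <= h -> (0 < i)%N -> (0 < j)%N ->
    process_sigma_algebra `[0, s] X A ->
    P (A `&` [set w | X s w = i] `&` [set w | X (s + h)%R w = j]) =
      (P (A `&` [set w | X s w = i]) * (p h i j)%:E)%E
}.

Arguments markov_chain_with_transition {d T R} P X p.

Definition birth_generator (R : realType) (lambda : nat -> R) (i j : nat) : R :=
  if j == i then - lambda i else if j == i.+1 then lambda i else 0.

Record pure_birth_process d (T : measurableType d) (R : realType)
    (P : probability T R) (lambda : nat -> R) (N : R -> {RV P >-> nat}) :
    Prop := {
  pb_start : forall w, N 0 w = 1%N;
  pb_right_continuous : forall (t : R) (w : T), 0 <= t ->
    \forall u \near t^'+, N u w = N t w;
  pb_nondecreasing : forall (s t : R) (w : T),
    0 <= s -> s <= t -> (N s w <= N t w)%N;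
  pb_markov : exists2 p : R -> nat -> nat -> R,
    markov_chain_with_transition P N p &
    forall i j : nat, (0 < i)%N -> (0 < j)%N ->
      (p h i j - (i == j)%:R) / h @[h --> 0^'+] --> birth_generator lambda i j
}.

Arguments pure_birth_process {d T R} P lambda N.

(* inf {s >= 0 : X s w = x}.  A Brownian path reaches every level almost
   surely, so the value 0 that [inf] gives to the empty set is immaterial. *)
Definition first_passage_time (T : Type) (R : realType) (X : R -> T -> R)
    (x : R) (w : T) : R :=
  inf [set s : R | 0 <= s /\ X s w = x].

(* Since [enum 'I_n] is 0, ..., n - 1 and B j stands for B^(j+1), this is
   T^1 evaluated at (T^2 evaluated at (... (T^n evaluated at t))). *)
Definition iterated_first_passage_time (T : Type) (R : realType) (n : nat)
    (B : 'I_n -> R -> T -> R) (t : R) (w : T) : R :=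
  foldr (fun j x => first_passage_time (B j) x w) t (enum 'I_n).

(* Main.v *)
Require Import Defs.
From HB Require Import structures.
From mathcomp Require Import all_boot all_order all_algebra.
From mathcomp Require Import all_classical all_reals all_analysis.
From mathcomp Require Import measurable_realfun ring lra.

Set Implicit Arguments.
Unset Strict Implicit.
Unset Printing Implicit Defensive.

Import Order.TTheory GRing.Theory Num.Theory.
Import numFieldNormedType.Exports.

Local Open Scope classical_set_scope.
Local Open Scope ring_scope.

(* Idea.  The forward equations determine the state probabilities of N: they
   are linear combinations of the exponentials exp (- lambda m s), so
   conditioning on the iterated time, which is independent of N, reduces the
   claim to the Laplace transform of that time.  Optional stopping of the
   exponential martingale exp (a B_s - a^2 s / 2) gives
   E exp (- l T_x) = exp (- x sqrt (2 l)), so each of the n passages replaces l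
   by sqrt (2 l), and n iterations turn l into l^(1/2^n) 2^(1 - 1/2^n).
   Neither joint measurability nor product spaces of paths are needed: a
   process is evaluated at an independent random time by rounding the time to a
   grid, where finite-dimensional independence suffices, and passing to the
   limit by one-sided continuity of the paths. *)

(** * Expectations and independence *)

Lemma normal_prob_mgf (R : realType) (s a : R) : s != 0 ->
  (\int[normal_prob 0 s]_x (expR (a * x))%:E =
   (expR (a ^+ 2 * s ^+ 2 / 2))%:E)%E.
Proof.
move=> s0.
have dom : normal_prob 0 s `<< lebesgue_measure by exact: normal_prob_dominates.
have mexp : measurable_fun setT (EFin \o (fun x : R => expR (a * x))).
  by apply/measurable_EFinP; apply: measurableT_comp => //; apply: measurable_funM.
rewrite -(Radon_Nikodym_SigmaFinite.change_of_variables dom)//=.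
transitivity (\int[lebesgue_measure]_x
    ((expR (a ^+ 2 * s ^+ 2 / 2))%:E * (normal_pdf (a * s ^+ 2) s x)%:E)%E)%E.
  apply: ae_eq_integral => //.
  - apply: emeasurable_funM => //; apply: measurable_int.
    exact: (Radon_Nikodym_SigmaFinite.f_integrable dom).
  - apply: emeasurable_funM => //.
    by apply/measurable_EFinP; exact: measurable_normal_pdf.
  have fE : ae_eq lebesgue_measure setT
      (Radon_Nikodym_SigmaFinite.f (normal_prob 0 s) lebesgue_measure)
      (fun x => (normal_pdf 0 s x)%:E).
    apply: integral_ae_eq => //.
    + exact: (Radon_Nikodym_SigmaFinite.f_integrable dom).
    + by apply/measurable_EFinP; exact: measurable_normal_pdf.
    + by move=> E _ mE; rewrite -(Radon_Nikodym_SigmaFinite.f_integral dom).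
  apply: filterS fE => x /(_ I) /= -> _.
  rewrite -!EFinM !normal_pdfE//= /normal_fun.
  rewrite mulrCA [in RHS]mulrCA -!expRD; congr ((_ * expR _)%:E).
  by field.
rewrite ge0_integralZl//.
- by rewrite integral_normal_pdf mule1.
- by apply/measurable_EFinP; exact: measurable_normal_pdf.
- by move=> x _; rewrite lee_fin normal_pdf_ge0.
Qed.

Section independence.
Context d (T : measurableType d) (R : realType) (P : probability T R).

Lemma integral_indep_mul (f g : T -> R) :
  measurable_fun setT f -> measurable_fun setT g ->
  (forall w, 0 <= f w) -> (forall w, 0 <= g w) ->
  (forall A B : set R, measurable A -> measurable B ->
     P (f @^-1` A `&` g @^-1` B) = (P (f @^-1` A) * P (g @^-1` B))%E) ->
  (\int[P]_w (f w * g w)%:E = \int[P]_w (f w)%:E * \int[P]_w (g w)%:E)%E.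
Proof.
move=> mf mg f0 g0 fg.
pose F : {mfun T >-> R} := HB.pack f (isMeasurableFun.Build _ _ _ _ _ mf).
pose G : {mfun T >-> R} := HB.pack g (isMeasurableFun.Build _ _ _ _ _ mg).
have mfg : measurable_fun setT (fun w => (f w, g w)) by exact: measurable_fun_pair.
pose FG : {mfun T >-> (R * R)%type} :=
  HB.pack (fun w => (f w, g w)) (isMeasurableFun.Build _ _ _ _ _ mfg).
pose h (z : R * R) := (Num.max z.1 0 * Num.max z.2 0)%:E.
have mh : measurable_fun setT h.
  apply/measurable_EFinP; apply: measurable_funM.
    by apply: measurable_maxr => //; exact: measurable_fst.
  by apply: measurable_maxr => //; exact: measurable_snd.
have h0 z : (0 <= h z)%E by rewrite lee_fin mulr_ge0// le_max lexx orbT.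
have mmax : measurable_fun setT (EFin \o (fun x : R => Num.max x 0)).
  by apply/measurable_EFinP; apply: measurable_maxr.
have max0 (x : R) : (0 <= (Num.max x 0)%:E)%E by rewrite lee_fin le_max lexx orbT.
transitivity (\int[P]_w h (FG w))%E.
  by apply: eq_integral => w _; rewrite /h/= !max_l.
have maxl (k : T -> R) : (forall w, 0 <= k w) ->
  (\int[P]_w (k w)%:E = \int[P]_w (Num.max (k w) 0)%:E)%E.
  by move=> k0; apply: eq_integral => w _; rewrite max_l.
rewrite (maxl f)// (maxl g)//.
rewrite -(@ge0_integral_distribution _ _ _ _ _ P FG h mh h0).
rewrite -(@ge0_integral_distribution _ _ _ _ _ P F _ mmax)//.
rewrite -(@ge0_integral_distribution _ _ _ _ _ P G _ mmax)//.
transitivity (\int[distribution P F \x distribution P G]_z h z)%E.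
  apply: eq_measure_integral => A mA _; apply/esym.
  by apply: product_measure_unique => // A1 B mA1 mB.
rewrite fubini_tonelli1// /fubini_F/=.
under eq_integral => x _.
  rewrite /h/=; under eq_integral do rewrite EFinM.
  rewrite ge0_integralZl//.
  over.
rewrite ge0_integralZr//.
by apply: integral_ge0.
Qed.

Lemma integral_indep_event (H : set T) (f : T -> R) :
  measurable H -> measurable_fun setT f -> (forall w, 0 <= f w) ->
  (forall B : set R, measurable B ->
     P (H `&` f @^-1` B) = (P H * P (f @^-1` B))%E) ->
  (\int[P]_(w in H) (f w)%:E = P H * \int[P]_w (f w)%:E)%E.
Proof.
move=> mH mf f0 Hf.
have -> : (P H = \int[P]_w (\1_H w)%:E)%E by rewrite integral_indic// setIT.
rewrite -integral_indep_mul//.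
  rewrite integral_mkcond; apply: eq_integral => w _.
  rewrite patchE indicE; case: ifPn => _; first by rewrite mul1r.
  by rewrite mul0r.
move=> A B mA mB.
have mfB : measurable (f @^-1` B) by rewrite -[X in measurable X]setTI; exact: mf.
have HCf : P (~` H `&` f @^-1` B) = (P (~` H) * P (f @^-1` B))%E.
  rewrite [~` _ `&` _]setIC -setDE measureD//; last first.
    by rewrite -ge0_fin_numE//; exact: fin_num_measure.
  rewrite [X in (_ - X)%E](_ : _ = (P H * P (f @^-1` B))%E); last first.
    by rewrite setIC; exact: Hf.
  rewrite probability_setC// muleBl ?mul1e//.
  exact: fin_num_measure.
rewrite preimage_indic; case: ifPn => _; case: ifPn => _.
- by rewrite setTI probability_setT mul1e.
- exact: Hf.
- exact: HCf.
- by rewrite set0I measure0 mul0e.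
Qed.
End independence.

(** * Evaluating a family of variables at an independent random index *)

Section freezing.
Context d (T : measurableType d) (R : realType) (P : probability T R).

Lemma probability_setD (A B : set T) : measurable A -> measurable B ->
  B `<=` A -> P (A `\` B) = (P A - P B)%E.
Proof.
move=> mA mB BA; rewrite measureD//.
  by rewrite [X in (_ - _ X)%E]setIidr.
by rewrite -ge0_fin_numE//; exact: fin_num_measure.
Qed.

Lemma bounded_convergence (D : set T) (f_ : nat -> T -> R) (f : T -> R) (C : R) :
  measurable D -> (forall n, measurable_fun D (f_ n)) -> measurable_fun D f ->
  (forall n w, 0 <= f_ n w <= C) ->
  {ae P, forall w, f_ n w @[n --> \oo] --> f w} ->
  (\int[P]_(w in D) (f_ n w)%:E @[n --> \oo] --> \int[P]_(w in D) (f w)%:E)%E.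
Proof.
move=> mD mf_ mf fC ff.
have [] := @dominated_convergence _ _ _ P D mD (fun n w => (f_ n w)%:E)
  (fun w => (f w)%:E) (EFin \o cst C).
- by move=> n; apply/measurable_EFinP.
- exact/measurable_EFinP.
- by apply: filterS ff => w fw _; apply: cvg_EFin => //; exact: nearW.
- exact: finite_measure_integrable_cst.
- apply: aeW => w n _ /=; have /andP[f0 f1] := fC n w.
  by rewrite lee_fin ger0_norm.
- by [].
Qed.

(* [e = 0] approximates [y] from above (weakly), [e = 1] strictly from below. *)
Definition grid (e : R) (m : nat) (y : R) : R :=
  ((Num.ceil (y * m.+1%:R))%:~R - e) / m.+1%:R.

Lemma grid0_ge m y : y <= grid 0 m y.
Proof. by rewrite /grid subr0 ler_pdivlMr ?ltr0n// ceil_ge. Qed.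

Lemma grid1_lt m y : grid 1 m y < y.
Proof.
rewrite /grid ltr_pdivrMr ?ltr0n//; have /andP[+ _] := ceil_itv (y * m.+1%:R).
by rewrite intrD.
Qed.

Lemma grid_cvg e y : grid e m y @[m --> \oo] --> y.
Proof.
have g0 : grid 0 m y @[m --> \oo] --> y.
  apply: (@squeeze_cvgr _ _ _ _ (fun=> y) (fun m => y + harmonic m)).
  - apply: nearW => m; rewrite grid0_ge /harmonic/=.
    have := grid1_lt m y; rewrite /grid subr0 mulrBl => /ltW.
    by rewrite lerBlDr div1r.
  - exact: cvg_cst.
  - rewrite -[X in _ --> X]addr0; apply: cvgD; first exact: cvg_cst.
    exact: cvg_harmonic.
have -> : (fun m => grid e m y) = (fun m => grid 0 m y - e * harmonic m).
  by apply/funext => m; rewrite /grid /harmonic/= subr0 mulrBl.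
rewrite -[X in _ --> X]subr0 -[X in _ - X](mulr0 e).
by apply: cvgB => //; apply: cvgM; [exact: cvg_cst|exact: cvg_harmonic].
Qed.

(* Tested on rays only: this is enough for the cells of the grid, which are
   differences of rays. *)
Definition indep_freeze (G : set T) (Y : T -> R) (X : R -> T -> R) :=
  forall (u a : R) (B : set R), measurable B ->
  P (G `&` [set w | a < Y w] `&` X u @^-1` B) =
  (P G * P [set w | (a < Y w)%R] * P (X u @^-1` B))%E.

Section freeze.
Variables (Y : T -> R) (X : R -> T -> R).
Hypotheses (mY : measurable_fun setT Y) (Y0 : forall w, 0 <= Y w).
Hypotheses (mX : forall u, measurable_fun setT (X u)).
Hypotheses (X01 : forall u w, 0 <= X u w <= 1).

Let cell (m i : nat) : set T :=
  [set w | (i%:R - 1) / m.+1%:R < Y w] `\` [set w | i%:R / m.+1%:R < Y w].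

Let mray a : measurable [set w | a < Y w].
Proof.
by rewrite -[X in measurable X]setTI; apply: measurable_fun_ltr => //.
Qed.

Let mcell m i : measurable (cell m i).
Proof. exact: measurableD. Qed.

Let cellP m i w : cell m i w <-> Num.ceil (Y w * m.+1%:R) = i%:Z.
Proof.
have m0 : 0 < m.+1%:R :> R by rewrite ltr0n.
rewrite /cell/=; split.
  move=> [h1 /negP]; rewrite -leNgt => h2; apply: ceil_def.
  rewrite intrD mulrNz mulr1z -[i%:~R]/(i%:R : R).
  by rewrite -ltr_pdivrMr// h1/= -ler_pdivlMr.
move=> h; have := ceil_itv (Y w * m.+1%:R).
rewrite h intrD mulrNz mulr1z -[i%:~R]/(i%:R : R) => /andP[h1 h2].
rewrite ltr_pdivrMr// h1; split => //; apply/negP.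
by rewrite -leNgt ler_pdivlMr.
Qed.

Let cell_cover m : \bigcup_i cell m i = setT.
Proof.
apply/seteqP; split => // w _.
have : 0 <= Num.ceil (Y w * m.+1%:R).
  by rewrite ceil_ge0; apply: (@lt_le_trans _ _ 0) => //; rewrite mulr_ge0.
move=> /gez0_abs h; exists `|Num.ceil (Y w * m.+1%:R)|%N => //.
by apply/cellP.
Qed.

Let trivIset_cell m (G : set T) : trivIset setT (fun i => G `&` cell m i).
Proof.
apply/trivIsetP => i j _ _ ij; rewrite -subset0 => w [[_ /cellP hi] [_ /cellP hj]].
by move: ij; rewrite hi in hj; case: hj => ->; rewrite eqxx.
Qed.

Let cell_grid e m i w : cell m i w -> grid e m (Y w) = (i%:R - e) / m.+1%:R.
Proof. by move=> /cellP; rewrite /grid => ->. Qed.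

Lemma measurable_freeze_grid e m :
  measurable_fun setT (fun w => X (grid e m (Y w)) w).
Proof.
rewrite -(cell_cover m); apply/measurable_fun_bigcup => // i.
apply: (eq_measurable_fun (X ((i%:R - e) / m.+1%:R))).
  by move=> w; rewrite inE => /(cell_grid e) ->.
exact: measurable_funTS.
Qed.

Let freeze_cell (G : set T) m i u : measurable G -> indep_freeze G Y X ->
  (\int[P]_(w in G `&` cell m i) (X u w)%:E =
   P G * (P (cell m i) * \int[P]_w (X u w)%:E))%E.
Proof.
move=> mG GYX.
have cellE (B : set R) : measurable B ->
  P (G `&` cell m i `&` X u @^-1` B) = (P G * P (cell m i) * P (X u @^-1` B))%E.
  move=> mB.
  have mXB : measurable (X u @^-1` B) by rewrite -[X in measurable X]setTI; exact: mX.
  have fin (A : set T) : measurable A -> P A \is a fin_num.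
    by move=> ?; exact: fin_num_measure.
  set A1 := [set w | (i%:R - 1) / m.+1%:R < Y w].
  set A2 := [set w | i%:R / m.+1%:R < Y w].
  have A21 : A2 `<=` A1.
    move=> w /=; apply: le_lt_trans; rewrite ler_pM2r ?invr_gt0 ?ltr0n//.
    by rewrite gerBl.
  have -> : G `&` cell m i `&` X u @^-1` B =
      (G `&` A1 `&` X u @^-1` B) `\` (G `&` A2 `&` X u @^-1` B).
    apply/seteqP; split => w /=.
      by move=> [[Gw [h1 h2]] h3]; split => // -[[_ ]].
    move=> [[[Gw h1] h3] h2]; split => //; split => //; split => // h4.
    by apply: h2.
  have mA1 : measurable A1 by exact: mray.
  have mA2 : measurable A2 by exact: mray.
  have mm A : measurable A -> measurable (G `&` A `&` X u @^-1` B).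
    by move=> mA; apply: measurableI => //; exact: measurableI.
  rewrite probability_setD; [|exact: mm|exact: mm|by move=> w [[? /A21 ?] ?]].
  rewrite !GYX// -/A1 -/A2 -!muleA.
  have -> : P (cell m i) = (P A1 - P A2)%E by exact: probability_setD.
  rewrite -(fineK (fin _ mG)) -(fineK (fin _ mXB)).
  rewrite -(fineK (fin _ mA1)) -(fineK (fin _ mA2)) -!EFinM -!EFinB.
  by congr (_%:E); ring.
have PGc : P (G `&` cell m i) = (P G * P (cell m i))%E.
  have := cellE setT measurableT.
  by rewrite preimage_setT setIT probability_setT mule1.
rewrite muleA -PGc.
apply: integral_indep_event => //.
- exact: measurableI.
- by move=> w; have /andP[] := X01 u w.
by move=> B mB; rewrite cellE// PGc.
Qed.

Let freeze_grid (G : set T) e m : measurable G -> indep_freeze G Y X ->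
  (\int[P]_(w in G) (X (grid e m (Y w)) w)%:E =
   P G * \sum_(0 <= i <oo) (P (cell m i) *
           \int[P]_w (X ((i%:R - e) / m.+1%:R)%R w)%:E))%E.
Proof.
move=> mG GYX.
have GE : G = \bigcup_i (G `&` cell m i) by rewrite -setI_bigcupr cell_cover setIT.
rewrite [in LHS]GE ge0_integral_bigcup//; first last.
- by move=> w _; rewrite lee_fin; have /andP[] := X01 (grid e m (Y w)) w.
- exact/measurable_EFinP/measurable_funTS/measurable_freeze_grid.
- by move=> i; exact: measurableI.
have -> : P G = (fine (P G))%:E by rewrite fineK//; exact: fin_num_measure.
rewrite -nneseriesZl; last first.
  move=> i _; rewrite mule_ge0// integral_ge0// => w _.
  by rewrite lee_fin; case/andP: (X01 ((i%:R - e) / m.+1%:R) w).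
rewrite fineK; last exact: fin_num_measure.
apply: eq_eseriesr => i _; rewrite -freeze_cell//.
by apply: eq_integral => w; rewrite inE => -[_ /(cell_grid e) ->].
Qed.

Let cvg_freeze_grid (G : set T) e : measurable G ->
  measurable_fun setT (fun w => X (Y w) w) ->
  {ae P, forall w, X (grid e m (Y w)) w @[m --> \oo] --> X (Y w) w} ->
  (\int[P]_(w in G) (X (grid e m (Y w)) w)%:E @[m --> \oo] -->
   \int[P]_(w in G) (X (Y w) w)%:E)%E.
Proof.
move=> mG mXY cXY; apply: (@bounded_convergence _ _ _ 1) => //.
- by move=> m; exact/measurable_funTS/measurable_freeze_grid.
- exact: measurable_funTS.
Qed.

Lemma integral_freeze_indep (G : set T) e : measurable G ->
  measurable_fun setT (fun w => X (Y w) w) ->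
  {ae P, forall w, X (grid e m (Y w)) w @[m --> \oo] --> X (Y w) w} ->
  indep_freeze G Y X -> indep_freeze setT Y X ->
  (\int[P]_(w in G) (X (Y w) w)%:E = P G * \int[P]_w (X (Y w) w)%:E)%E.
Proof.
move=> mG mXY cXY iG iT.
have cG := cvg_freeze_grid mG mXY cXY.
have cT := cvg_freeze_grid measurableT mXY cXY.
have E : (fun m => \int[P]_(w in G) (X (grid e m (Y w)) w)%:E)%E =
    (fun m => P G * \int[P]_w (X (grid e m (Y w)) w)%:E)%E.
  by apply/funext => m; rewrite !freeze_grid// probability_setT mul1e.
rewrite E in cG; apply: (cvg_unique _ cG) => //.
by apply: cvgeMl => //; exact: fin_num_measure.
Qed.

Lemma integral_freeze (g : R -> R) e : measurable_fun setT g ->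
  (forall u, (\int[P]_w (X u w)%:E = (g u)%:E)%E) ->
  measurable_fun setT (fun w => X (Y w) w) ->
  {ae P, forall w, X (grid e m (Y w)) w @[m --> \oo] --> X (Y w) w} ->
  {ae P, forall w, g (grid e m (Y w)) @[m --> \oo] --> g (Y w)} ->
  indep_freeze setT Y X ->
  (\int[P]_w (X (Y w) w)%:E = \int[P]_w (g (Y w))%:E)%E.
Proof.
move=> mg gE mXY cXY cgY iT.
have cT := cvg_freeze_grid measurableT mXY cXY.
apply: (cvg_unique _ cT) => //.
have g01 u : 0 <= g u <= 1.
  rewrite -!lee_fin -gE; apply/andP; split.
    by apply: integral_ge0 => w _; rewrite lee_fin; case/andP: (X01 u w).
  apply: (@le_trans _ _ (\int[P]_w (cst 1%E w))%E).
    apply: ge0_le_integral => //.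
    - by move=> w _; rewrite lee_fin; case/andP: (X01 u w).
    - exact/measurable_EFinP.
    - by move=> w _; rewrite lee_fin; case/andP: (X01 u w).
  by rewrite integral_cst// mul1e; exact: probability_le1.
have mgY u e' : measurable_fun setT (fun w => g (grid e' u (Y w))).
  apply: (measurableT_comp mg).
  apply: measurable_funM => //; apply: measurable_funB => //.
  have mceil : measurable_fun setT (fun x : R => (Num.ceil x)%:~R : R).
    apply: nondecreasing_measurable => // x y xy.
    by rewrite ler_int le_ceil.
  by apply: (measurableT_comp mceil); exact: measurable_funM.
have -> : (fun m => \int[P]_w (X (grid e m (Y w)) w)%:E)%E =
          (fun m => \int[P]_w (g (grid e m (Y w)))%:E)%E.
  apply/funext => m; rewrite freeze_grid// probability_setT mul1e.
  rewrite -[in RHS](cell_cover m) ge0_integral_bigcup//; first last.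
  - by have := @trivIset_cell m setT; under eq_fun do rewrite setTI.
  - by move=> w _; rewrite lee_fin; have /andP[] := g01 (grid e m (Y w)).
  - by apply/measurable_EFinP; exact: measurable_funTS.
  apply: eq_eseriesr => i _; rewrite gE muleC.
  rewrite -integral_cst//; apply: eq_integral => w.
  by rewrite inE => /(cell_grid e) ->.
apply: (@bounded_convergence _ _ _ 1) => //.
exact: measurableT_comp.
Qed.

End freeze.
End freezing.

(** * State probabilities of the pure birth process *)

Section birth_weights.
Context (K : fieldType).
Implicit Types a : nat -> K.

Definition birth_weight a (k m : nat) : K :=
  (\prod_(1 <= l < k.+1 | l != m) (a l - a m))^-1.

Lemma birth_weight_recl a k m : (m < k.+1)%N ->
  birth_weight a k.+1 m = birth_weight a k m / (a k.+1 - a m).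
Proof.
move=> mk; rewrite /birth_weight big_mkcond big_nat_recr//= -big_mkcond/=.
by rewrite gtn_eqF// invfM.
Qed.

Lemma birth_weight_recr a k :
  birth_weight a k.+1 k.+1 = (\prod_(1 <= l < k.+1) (a l - a k.+1))^-1.
Proof.
rewrite /birth_weight big_mkcond big_nat_recr//= eqxx/= mulr1.
congr (_^-1); rewrite !big_nat; apply: eq_bigr => l /andP[_ lk].
by rewrite ltn_eqF.
Qed.

Lemma partial_fractions a k x :
  (forall i j, (0 < i)%N -> (0 < j)%N -> i <> j -> a i <> a j) ->
  (forall l, (0 < l <= k.+1)%N -> a l != x) ->
  \sum_(1 <= m < k.+2) birth_weight a k.+1 m / (a m - x) =
  (\prod_(1 <= l < k.+2) (a l - x))^-1.
Proof.
move=> ainj; elim: k x => [|k IH] x ax.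
  by rewrite !big_nat1 /birth_weight big_mkcond big_nat1 eqxx invr1 mul1r.
have aD i j : (0 < i)%N -> (0 < j)%N -> i != j -> a i - a j != 0.
  by move=> i0 j0 /eqP ij; rewrite subr_eq0; apply/eqP/ainj.
have kx : a k.+2 - x != 0 by rewrite subr_eq0 ax// leqnn.
rewrite big_nat_recr// [in RHS]big_nat_recr//= invfM -IH; last first.
  by move=> l /andP[l0 lk]; apply: ax; rewrite l0 (leq_trans lk).
rewrite birth_weight_recr -IH; last first.
  by move=> l /andP[l0 lk]; rewrite -subr_eq0 aD// ltn_eqF.
rewrite !mulr_suml -big_split/= !big_nat; apply: eq_bigr => m /andP[m0 mk].
rewrite birth_weight_recl//.
have mx : a m - x != 0 by rewrite subr_eq0 ax// m0 ltnW.
have mk1 : a m - a k.+2 != 0 by rewrite aD// ltn_eqF.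
have mk2 : a k.+2 - a m != 0 by rewrite aD// gtn_eqF.
by field; rewrite mx mk1 mk2 kx.
Qed.

Lemma sum_birth_weight a k :
  (forall i j, (0 < i)%N -> (0 < j)%N -> i <> j -> a i <> a j) ->
  \sum_(1 <= m < k.+3) birth_weight a k.+2 m = 0.
Proof.
move=> ainj; rewrite big_nat_recr//= birth_weight_recr -partial_fractions//.
  rewrite -big_split/= big_nat big1// => m /andP[m0 mk].
  rewrite birth_weight_recl//.
  have mk1 : a m - a k.+2 != 0.
    by rewrite subr_eq0; apply/eqP/ainj => // /eqP; rewrite ltn_eqF.
  have mk2 : a k.+2 - a m != 0 by rewrite -opprB oppr_eq0.
  by field; rewrite mk1 mk2.
move=> l /andP[l0 lk]; apply/eqP/ainj => // /eqP; rewrite ltn_eqF//.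
Qed.
End birth_weights.

Lemma cvg_sum_nat (T : Type) (F : set_system T) (FF : Filter F) (R : realType)
    (m n : nat) (f : nat -> T -> R) (l : nat -> R) :
  (forall i, (m <= i < n)%N -> f i x @[x --> F] --> l i) ->
  \sum_(m <= i < n) f i x @[x --> F] --> \sum_(m <= i < n) l i.
Proof.
move=> fl; rewrite big_nat.
rewrite (_ : (fun x => _) = fun x => \sum_(m <= i < n | (m <= i < n)%N) f i x).
  by apply: cvg_big => //; exact: add_continuous.
by apply/funext => x; rewrite big_nat.
Qed.

Lemma dnbhs_lt (R : realType) (e : R) : 0 < e -> \forall h \near (0 : R)^', `|h| < e.
Proof. by move=> e0; exists e => //= h; rewrite /ball/= sub0r normrN. Qed.

Lemma is_derive_cvg (R : realType) (f : R -> R) (x df : R) :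
  is_derive x 1 f df -> f y @[y --> x] --> f x.
Proof. by move=> [dfx _]; exact/differentiable_continuous/derivable1_diffP. Qed.

Section birth_law.
Context d (T : measurableType d) (R : realType) (P : probability T R).
Variables (lambda : nat -> R) (N : R -> {RV P >-> nat}).
Hypothesis lambda_neq : forall k l, (0 < k)%N -> (0 < l)%N -> k <> l ->
  lambda k <> lambda l.
Hypothesis N_birth : pure_birth_process P lambda N.

Definition birth_prob k (s : R) : R :=
  (\prod_(1 <= j < k) lambda j) *
  \sum_(1 <= m < k.+1) expR (- (lambda m * s)) * birth_weight lambda k m.

Lemma birth_prob0 k : (0 < k)%N -> birth_prob k 0 = (k == 1%N)%:R.
Proof.
rewrite /birth_prob; under [X in _ * X]eq_bigr do rewrite mulr0 oppr0 expR0 mul1r.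
case: k => [//|[|k]] _.
  by rewrite big_geq// big_nat1 /birth_weight big_mkcond big_nat1 eqxx invr1 mulr1.
by rewrite sum_birth_weight// mulr0.
Qed.

Lemma is_derive_sum_nat (m n : nat) (F : nat -> R -> R) (dF : nat -> R) (x : R) :
  (forall i, is_derive x 1 (F i) (dF i)) ->
  is_derive x 1 (fun y => \sum_(m <= i < n) F i y) (\sum_(m <= i < n) dF i).
Proof.
move=> dFi; elim: n => [|n IH].
  under eq_fun do rewrite big_geq//; rewrite big_geq//; exact: is_derive_cst.
have [mn|nm] := leqP m n; last first.
  under eq_fun do rewrite big_geq//; rewrite big_geq//; exact: is_derive_cst.
under eq_fun do rewrite big_nat_recr//=; rewrite big_nat_recr//=.
exact: is_deriveD.
Qed.

Lemma is_derive_birth_prob k (s : R) : (0 < k)%N ->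
  is_derive s 1 (birth_prob k)
    (- lambda k * birth_prob k s +
     (if (1 < k)%N then lambda k.-1 * birth_prob k.-1 s else 0)).
Proof.
move=> k0.
have dterm m : is_derive s 1 (fun s => expR (- (lambda m * s)) * birth_weight lambda k m)
    (- lambda m * (expR (- (lambda m * s)) * birth_weight lambda k m)).
  have dlin : is_derive s 1 (fun s => - (lambda m * s)) (- lambda m).
    have := is_deriveZ (- lambda m) (is_derive_id s 1).
    rewrite /GRing.scale/= mulr1; congr is_derive.
    by apply/funext => y ; exact: mulNr.
  have dexp := is_derive1_comp (is_derive_expR _) dlin.
  have dmul := is_deriveZ (birth_weight lambda k m) dexp.
  rewrite (_ : (fun s => _ * _) =
    birth_weight lambda k m \*: (expR \o (fun s => - (lambda m * s)))); last first.
    by apply/funext => y /=; rewrite mulrC.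
  apply: is_derive_eq.
  by rewrite /GRing.scale/=; ring.
have dsum := is_derive_sum_nat 1 k.+1 dterm.
apply: (is_derive_eq (is_deriveZ (\prod_(1 <= j < k) lambda j) dsum)).
rewrite /GRing.scale/= /birth_prob.
case: k k0 dterm dsum => [//|[|k]] _ _ _.
  by rewrite !big_nat1 big_geq//=; ring.
rewrite /= big_nat_recr//=.
have -> : \sum_(1 <= m < k.+3)
     - lambda m * (expR (- (lambda m * s)) * birth_weight lambda k.+2 m) =
   - lambda k.+2 * (\sum_(1 <= m < k.+3)
       expR (- (lambda m * s)) * birth_weight lambda k.+2 m) +
   \sum_(1 <= m < k.+2) expR (- (lambda m * s)) * birth_weight lambda k.+1 m.
  rewrite big_nat_recr//= [in RHS]big_nat_recr//= mulrDr addrAC; congr (_ + _).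
  rewrite mulr_sumr -big_split/= !big_nat; apply: eq_bigr => m /andP[m0 mk].
  rewrite birth_weight_recl//.
  have mk2 : lambda k.+2 - lambda m != 0.
    by rewrite subr_eq0; apply/eqP/lambda_neq => // /eqP; rewrite gtn_eqF.
  by field.
by ring.
Qed.

Let q k s : R := fine (P [set w | N s w = k]).

Let mN k s : measurable [set w | N s w = k].
Proof.
rewrite -[X in measurable X]setTI.
exact: (measurable_funP (N s) measurableT [set k]).
Qed.

Let qE k s : P [set w | N s w = k] = (q k s)%:E.
Proof. by rewrite /q fineK//; exact: fin_num_measure. Qed.

Let q01 k s : 0 <= q k s <= 1.
Proof. by rewrite -!lee_fin -qE measure_ge0 probability_le1. Qed.

Lemma birth_chapman_kolmogorov (p : R -> nat -> nat -> R) (s h : R) k :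
  markov_chain_with_transition P N p -> 0 <= s -> 0 <= h -> (0 < k)%N ->
  q k (s + h) = \sum_(1 <= i < k.+1) q i s * p h i k.
Proof.
move=> pM s0 h0 k0.
apply/EFin_inj; rewrite -qE -sumEFin.
have sumP n : P ([set w | (0 < N s w < n.+1)%N] `&` [set w | N (s + h) w = k]) =
    (\sum_(1 <= i < n.+1) (q i s * p h i k)%:E)%E.
  elim: n => [|n IH].
    rewrite big_geq// (_ : _ `&` _ = set0) ?measure0//.
    by rewrite -subset0 => w [/= /andP[h1 h2]]; move: (leq_trans h1 h2).
  rewrite big_nat_recr//= -IH EFinM -qE.
  have := mc_markov pM s0 h0 (ltn0Sn n) k0 (A := setT); rewrite !setTI => <-; last first.
    exact: (@measurableT _ (g_sigma_algebraType _)).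
  rewrite -measureU; last 3 first.
  - apply: measurableI => //; rewrite -[X in measurable X]setTI.
    exact: (measurable_funP (N s) measurableT [set j | (0 < j < n.+1)%N]).
  - exact: measurableI.
  - rewrite -subset0 => w [[/= /andP[_ +] _] [+ _]] => /[swap] ->.
    by rewrite ltnn.
  congr (P _); apply/seteqP; split => w /=.
    move=> [/andP[N0 Nn] Nk]; move: Nn; rewrite ltnS leq_eqVlt => /orP[/eqP|] Nn.
      by right.
    by left; rewrite N0.
  move=> [[/andP[N0 Nn] Nk]|[Nn Nk]]; split => //.
    by rewrite N0 (leq_trans Nn).
  by rewrite Nn ltnSn.
rewrite -sumP; congr (P _); apply/seteqP; split => w /=; last by case.
move=> Nk; split => //; rewrite (mc_state pM)//= ltnS -Nk.
by apply: (pb_nondecreasing N_birth) => //; rewrite lerDl.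
Qed.

Let sum_eqb (x : nat -> R) k : (0 < k)%N ->
  \sum_(1 <= i < k.+1) x i * (i == k)%:R = x k.
Proof.
move=> k0; rewrite big_nat_recr//= eqxx mulr1 big_nat big1 ?add0r// => i /andP[_ ik].
by rewrite ltn_eqF// mulr0.
Qed.

Section ode.
Variable p : R -> nat -> nat -> R.
Hypothesis pM : markov_chain_with_transition P N p.
Hypothesis pD : forall i j : nat, (0 < i)%N -> (0 < j)%N ->
  (p h i j - (i == j)%:R) / h @[h --> 0^'+] --> birth_generator lambda i j.

Let D i k (h : R) : R := (p `|h| i k - (i == k)%:R) / `|h|.

(* One formula for both signs of [h], so that two-sided derivatives follow from
   the one-sided generator limit. *)
Let q_incr (s h : R) k : 0 <= s -> 0 <= s + h -> h != 0 -> (0 < k)%N ->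
  q k (s + h) - q k s = h * \sum_(1 <= i < k.+1) q i (Num.min s (s + h)) * D i k h.
Proof.
move=> s0 sh0 h0 k0.
have E x : h * (\sum_(1 <= i < k.+1) q i x * D i k h) =
    Num.sg h * (\sum_(1 <= i < k.+1) q i x * p `|h| i k - q k x).
  rewrite -[X in _ - X](sum_eqb (fun i => q i x) k0) -sumrB !mulr_sumr.
  apply: eq_bigr => i _; rewrite /D {1}[h]numEsg.
  by field; rewrite normr_eq0.
rewrite E; move: h0; rewrite neq_lt => /orP[h0|h0].
  have sh : s + h < s by rewrite gtrDl.
  rewrite min_r ?(ltW sh)// ltr0_sg// ltr0_norm// -birth_chapman_kolmogorov//.
    by rewrite addrK; ring.
  by rewrite oppr_ge0 ltW.
have sh : s < s + h by rewrite ltrDl.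
rewrite min_l ?(ltW sh)// gtr0_sg// gtr0_norm//.
by rewrite -birth_chapman_kolmogorov// ?mul1r// ltW.
Qed.

Let D_cvg i k : (0 < i)%N -> (0 < k)%N ->
  D i k h @[h --> 0^'] --> birth_generator lambda i k.
Proof.
move=> i0 k0; apply/cvgrPdist_le => e e0.
have /cvgrPdist_le/(_ e e0)[r /= r0 H] := pD i0 k0.
exists r => //= h; rewrite /ball/= !sub0r !normrN => hr h0.
by apply: H; rewrite /ball/= ?sub0r ?normrN ?normr_id// normr_gt0.
Qed.

Let B k (h : R) : R := `|h| * \sum_(1 <= i < k.+1) `|D i k h|.

Let B_cvg k : (0 < k)%N -> B k h @[h --> 0^'] --> 0.
Proof.
move=> k0.
rewrite -[X in _ --> X](mul0r (\sum_(1 <= i < k.+1) `|birth_generator lambda i k|)).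
apply: cvgM.
  apply/cvgr0Pnorm_lt => e e0; apply: filterS (dnbhs_lt e0) => h; by rewrite normr_id.

apply: cvg_sum_nat => i /andP[i0 _]; apply: cvg_norm; exact: D_cvg.
Unshelve. all: by end_near.
Qed.

Let q_le (s h : R) k : 0 <= s -> 0 <= s + h -> (0 < k)%N ->
  `|q k (s + h) - q k s| <= B k h.
Proof.
move=> s0 sh0 k0; have [->|h0] := eqVneq h 0.
  by rewrite addr0 subrr normr0 mulr_ge0// sumr_ge0.
rewrite q_incr// normrM ler_wpM2l// (le_trans (ler_norm_sum _ _ _))//.
apply: ler_sum => i _; rewrite normrM -[leRHS]mul1r ler_wpM2r//.
by have /andP[q0 q1] := q01 i (Num.min s (s + h)); rewrite ger0_norm.
Qed.

Let q_min_cvg (s : R) k : 0 < s -> (0 < k)%N ->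
  q k (Num.min s (s + h)) @[h --> 0^'] --> q k s.
Proof.
move=> s0 k0; apply/cvgrPdist_le => e e0.
have /cvgr0Pnorm_le/(_ e e0) Be := B_cvg k0.
near=> h; have sh : 0 <= s + h.
  have : `|h| < s by near: h; exact: dnbhs_lt.
  by rewrite ltr_norml => /andP[h1 _]; rewrite -lerBlDl sub0r ltW.
have [hneg|hpos] := ltP h 0.
  have -> : Num.min s (s + h) = s + h by rewrite min_r// gerDl ltW.
  rewrite distrC; apply: le_trans (q_le (ltW s0) sh k0) _.
  by rewrite (le_trans (ler_norm _))//; near: h.
by rewrite min_l ?lerDl// subrr normr0 ltW.
Unshelve. all: by end_near.
Qed.

Lemma is_derive_q (s : R) k : 0 < s -> (0 < k)%N ->
  is_derive s 1 (q k) (\sum_(1 <= i < k.+1) q i s * birth_generator lambda i k).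
Proof.
move=> s0 k0.
have dq : h^-1 *: (q k (h *: 1 + s) - q k s) @[h --> 0^'] -->
    \sum_(1 <= i < k.+1) q i s * birth_generator lambda i k.
  have : \sum_(1 <= i < k.+1) q i (Num.min s (s + h)) * D i k h @[h --> 0^'] -->
    \sum_(1 <= i < k.+1) q i s * birth_generator lambda i k.
    apply: cvg_sum_nat => i /andP[i0 _]; apply: cvgM; first exact: q_min_cvg.
    exact: D_cvg.
  apply: cvg_trans; apply: near_eq_cvg; near=> h.
  have h0 : h != 0 by near: h; exact: nbhs_dnbhs_neq.
  have sh : 0 <= s + h.
    have : `|h| < s by near: h; exact: dnbhs_lt.
    by rewrite ltr_norml => /andP[h1 _]; rewrite -lerBlDl sub0r ltW.
  rewrite (_ : h *: 1 + s = s + h); last by rewrite addrC [_ *: _]mulr1.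
  rewrite q_incr ?(ltW s0)//.
  by rewrite /GRing.scale/= mulKf.
apply: DeriveDef; first by apply/cvg_ex; eexists; exact: dq.
exact: cvg_lim dq.
Unshelve. all: by end_near.
Qed.

Lemma q_right_continuous0 k : (0 < k)%N -> q k h @[h --> 0^'+] --> q k 0.
Proof.
move=> k0; apply/cvgrPdist_le => e e0.
have /cvgr0Pnorm_le/(_ e e0) Be := cvg_dnbhs_at_right (B_cvg k0).
near=> h; have h0 : 0 <= 0 + h by rewrite add0r ltW//; near: h; exact: nbhs_right_gt.
rewrite distrC -[X in q k X]add0r (le_trans (q_le (lexx 0) h0 k0))//.
by rewrite (le_trans (ler_norm _))//; near: h.
Unshelve. all: by end_near.
Qed.

End ode.

Lemma birth_generator_sum (s : R) k : (0 < k)%N ->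
  \sum_(1 <= i < k.+1) q i s * birth_generator lambda i k =
  - lambda k * q k s + (if (1 < k)%N then lambda k.-1 * q k.-1 s else 0).
Proof.
case: k => [//|k] _; rewrite big_nat_recr//= {2}/birth_generator eqxx.
rewrite addrC mulrC; congr (_ + _).
case: k => [|k]; first by rewrite big_geq.
rewrite big_nat_recr//= /birth_generator eqxx gtn_eqF// mulrC big_nat big1 ?add0r//.
move=> i /andP[i0 ik]; rewrite gtn_eqF ?(ltn_trans ik)// eqSS gtn_eqF//.
by rewrite mulr0.
Qed.

Lemma birth_distribution k (s : R) : (0 < k)%N -> 0 <= s ->
  P [set w | N s w = k] = (birth_prob k s)%:E.
Proof.
move=> k0 s0; rewrite qE; congr (_%:E).
have [p pM pD] := pb_markov N_birth.
have q0 j : (0 < j)%N -> q j 0 = (j == 1%N)%:R.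
  move=> j0; rewrite /q; have [->|j1] := eqVneq j 1%N.
    rewrite [X in P X](_ : _ = setT) ?probability_setT//.
    by apply/seteqP; split => // w _; rewrite /= (pb_start N_birth).
  rewrite [X in P X](_ : _ = set0) ?measure0//.
  apply/seteqP; split => // w; rewrite /= (pb_start N_birth) => /esym/eqP.
  by rewrite (negbTE j1).
elim/ltn_ind: k k0 s s0 => k IH k0 b; rewrite le_eqVlt => /orP[/eqP<-|b0].
  by rewrite q0// birth_prob0.
pose u x := expR (lambda k * x) * (q k x - birth_prob k x).
have du (x : R) : 0 < x -> is_derive x 1 u 0.
  move=> x0.
  have dq := is_derive_q pM pD x0 k0.
  have dp := is_derive_birth_prob x k0.
  have dlin : is_derive x 1 (fun s => lambda k * s) (lambda k).
    have := is_deriveZ (lambda k) (is_derive_id x 1).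
    by rewrite /GRing.scale/= mulr1.
  have dexp := is_derive1_comp (is_derive_expR _) dlin.
  apply: (is_derive_eq (is_deriveM dexp (is_deriveB dq dp))).
  rewrite birth_generator_sum// /GRing.scale/=.
  rewrite -[(q k - birth_prob k) x]/(q k x - birth_prob k x).
  case: ifPn => k1; last by ring.
  rewrite (IH k.-1) ?prednK// ?(ltW x0)//; first by ring.
  by rewrite -ltnS prednK.
have cu : {within `[0, b], continuous u}.
  apply/continuous_within_itvP => //; split.
  - move=> x; rewrite in_itv/= => /andP[x0 _].
    exact: is_derive_cvg (du x x0).
  - apply: cvgM.
      apply: cvg_at_right_filter.
      have dlin : is_derive (0 : R) 1 (fun s => lambda k * s) (lambda k).
        have := is_deriveZ (lambda k) (is_derive_id (0 : R) 1).
        by rewrite /GRing.scale/= mulr1.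
      exact: is_derive_cvg (is_derive1_comp (is_derive_expR _) dlin).
    apply: cvgB; first exact: (q_right_continuous0 pM pD).
    by apply: cvg_at_right_filter; exact: is_derive_cvg (is_derive_birth_prob 0 k0).
  - apply: cvg_at_left_filter.
    exact: is_derive_cvg (du b b0).
have du0b x : x \in `]0, b[ -> is_derive x 1 u ((fun=> 0) x).
  by rewrite in_itv/= => /andP[x0 _]; exact: du.
have [c _] := @MVT R u (fun=> 0) 0 b b0 du0b cu.
rewrite mul0r => /eqP; rewrite subr_eq0 {2}/u q0// birth_prob0// subrr mulr0.
by rewrite mulf_eq0 gt_eqF ?expR_gt0//= subr_eq0 => /eqP.
Qed.

End birth_law.

(** * Running maximum and hitting times of a continuous path *)

Section continuous_paths.
Context (R : realType).
Implicit Types (g : R -> R) (s t u v x y : R).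

Definition running_max g u := sup [set g v | v in `[0, u]].

Definition hits g x := exists2 s, 0 <= s & g s = x.

Definition hitting_time g x := inf [set s | 0 <= s /\ g s = x].

Lemma running_max_attained g u : continuous g -> 0 <= u ->
  exists2 c, 0 <= c <= u & g c = running_max g u.
Proof.
move=> cg u0.
have cgu : {within `[0, u], continuous g} by exact: continuous_subspaceT.
have [c + cmax] := EVT_max u0 cgu; rewrite in_itv/= => cu; exists c => //.
apply/eqP; rewrite eq_le; apply/andP; split.
  apply: ub_le_sup; last by exists c => //=; rewrite in_itv.
  by exists (g c) => _ [v /= vu <-]; apply: cmax.
apply: ge_sup; first by exists (g c), c => //=; rewrite in_itv.
by move=> _ [v /= vu <-]; apply: cmax.
Qed.

Lemma running_max_ge g u v : continuous g -> 0 <= v <= u -> g v <= running_max g u.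
Proof.
move=> cg vu; have u0 : 0 <= u by case/andP: vu; exact: le_trans.
have cgu : {within `[0, u], continuous g} by exact: continuous_subspaceT.
have [c + cmax] := EVT_max u0 cgu; rewrite in_itv/= => cu.
apply: ub_le_sup; last by exists v => //=; rewrite in_itv.
by exists (g c) => _ [v' /= vu' <-]; apply: cmax.
Qed.

Lemma running_max_ltP g u x : continuous g -> 0 <= u ->
  running_max g u < x <-> forall v, 0 <= v <= u -> g v < x.
Proof.
move=> cg u0; split => [Mx v vu|H].
  exact: le_lt_trans (running_max_ge cg vu) Mx.
by have [c cu <-] := running_max_attained cg u0; apply: H.
Qed.

Lemma running_max_le g u v : continuous g -> 0 <= u <= v ->
  running_max g u <= running_max g v.
Proof.
move=> cg /andP[u0 uv]; have [c /andP[c0 cu] <-] := running_max_attained cg u0.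
by apply: running_max_ge => //; rewrite c0 (le_trans cu).
Qed.

Lemma running_max_grid g u y : continuous g -> 0 <= u ->
  running_max g u <= y <->
  forall n i : nat, (i <= n.+1)%N -> g (u * (i%:R / n.+1%:R)) <= y.
Proof.
move=> cg u0; split => [My n i ni|H].
  apply: le_trans My; apply: running_max_ge => //.
  rewrite mulr_ge0 ?divr_ge0//= ler_piMr// ler_pdivrMr ?ltr0n//.
  by rewrite mul1r ler_nat.
have [c /andP[c0 cu] <-] := running_max_attained cg u0.
have : (0 == u) || (0 < u) by rewrite -le_eqVlt.
move=> /orP[/eqP u00|{}u0].
  have -> : c = u * (0%:R / 1%:R).
    by rewrite mul0r mulr0; apply/le_anti; rewrite c0 [X in _ <= X]u00 cu.
  exact: (H 0%N 0%N isT).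
pose r := c / u.
have r0 : 0 <= r by rewrite divr_ge0// ltW.
have r1 : r <= 1 by rewrite ler_pdivrMr// mul1r.
pose q n := u * ((Num.truncn (r * n.+1%:R))%:R / n.+1%:R).
have qc : q n @[n --> \oo] --> c.
  have -> : c = u * r by rewrite /r mulrC divfK// gt_eqF.
  apply: cvgM; first exact: cvg_cst.
  apply: (@squeeze_cvgr _ _ _ _ (fun n => r - harmonic n) (fun=> r)).
  - apply: nearW => n; rewrite /harmonic/=.
    have n0 : 0 < n.+1%:R :> R by rewrite ltr0n.
    have rn : 0 <= r * n.+1%:R by rewrite mulr_ge0.
    have /andP[h1 h2] := truncn_itv rn.
    rewrite ler_pdivrMr// h1 andbT ler_pdivlMr// mulrBl mulVf ?gt_eqF//.
    by rewrite lerBlDr natr1 ltW.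
  - rewrite -[X in _ --> X]subr0; apply: cvgB; first exact: cvg_cst.
    exact: cvg_harmonic.
  - exact: cvg_cst.
have gq : g (q n) @[n --> \oo] --> g c.
  by apply: continuous_cvg; [exact: cg|exact: qc].
rewrite -(cvg_lim _ gq)//; apply: limr_le; first by apply/cvg_ex; eexists; exact: gq.
apply: nearW => n; apply: H.
have rn : 0 <= r * n.+1%:R by rewrite mulr_ge0.
rewrite -(ler_nat R) (le_trans _ (_ : r * n.+1%:R <= _))//.
  by have /andP[] := truncn_itv rn.
by rewrite ler_piMl.
Qed.

Lemma hits_running_max g x : continuous g -> g 0 = 0 -> 0 <= x ->
  hits g x <-> exists K : nat, x <= running_max g K%:R.
Proof.
move=> cg g0 x0; split => [[s s0 <-]|[K]].
  exists (Num.truncn s).+1; apply: running_max_ge => //.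
  by rewrite s0 ltW// truncnS_gt.
have [c /andP[c0 cK] <-] := running_max_attained cg (ler0n _ K) => xc.
have cgc : {within `[0, c], continuous g} by exact: continuous_subspaceT.
have [|s] := @IVT _ g 0 c x c0 cgc; last first.
  by rewrite in_itv/= => /andP[s0 _] gs; exists s.
by rewrite g0 ge_min x0 le_max xc orbT.
Qed.

Lemma hitting_time_ge0 g x : 0 <= hitting_time g x.
Proof.
have [hx|hx] := pselect ([set s | 0 <= s /\ g s = x] !=set0).
  by apply: lb_le_inf => // s [].
rewrite /hitting_time (_ : [set _ | _] = set0) ?inf0// -subset0 => s hs.
by apply: hx; exists s.
Qed.

Lemma hitting_timeE g x : continuous g -> hits g x -> g (hitting_time g x) = x.
Proof.
move=> cg [s0 s00 gs0]; set S := [set s | 0 <= s /\ g s = x].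
have hS : has_inf S by split; [exists s0|exists 0 => s []].
have /cvgrPdist_lt cT := cg (hitting_time g x).
apply/eqP/negPn/negP => gT.
have e0 : 0 < `|g (hitting_time g x) - x| by rewrite normr_gt0 subr_eq0.
have [r /= r0 H] := cT _ e0.
have [s [ss0 gs] sT] := inf_adherent r0 hS.
have Ts : hitting_time g x <= s by apply: ge_inf => //; exact: hS.2.
have /H : ball_ Num.norm (hitting_time g x) r s.
  by rewrite /ball_/= distrC ger0_norm ?subr_ge0// ltrBlDl.
by rewrite /= gs ltxx.
Qed.

Lemma lt_hitting_time g x s : continuous g -> g 0 = 0 -> 0 <= x -> hits g x ->
  0 <= s -> s < hitting_time g x <-> running_max g s < x.
Proof.
move=> cg g0 x0 hx s0; split => [sT|].
  rewrite ltNge; apply/negP => xM.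
  have [c /andP[c0 cs] gc] := running_max_attained cg s0; rewrite -gc in xM.
  have cgc : {within `[0, c], continuous g} by exact: continuous_subspaceT.
  have [|v] := @IVT _ g 0 c x c0 cgc; first by rewrite g0 ge_min x0 le_max xM orbT.
  rewrite in_itv/= => /andP[v0 vc] gv.
  have : hitting_time g x <= v by apply: ge_inf => //; exists 0 => ? [].
  by rewrite leNgt (le_lt_trans vc)// (le_lt_trans cs).
move=> /(running_max_ltP _ cg s0) H; rewrite ltNge; apply/negP => Ts.
have := H (hitting_time g x); rewrite hitting_time_ge0 Ts hitting_timeE// ltxx.
by move=> /(_ isT).
Qed.

Lemma hitting_time_left_cvg g x (u : nat -> R) : continuous g -> g 0 = 0 ->
  (forall y, 0 <= y -> hits g y) -> 0 <= x ->
  (forall n, u n < x) -> u n @[n --> \oo] --> x ->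
  hitting_time g (Num.max (u n) 0) @[n --> \oo] --> hitting_time g x.
Proof.
move=> cg g0 hg x0 ux cu; apply/cvgrPdist_lt => e e0.
have max0 y : 0 <= Num.max y 0 by rewrite le_max lexx orbT.
have Tle n : hitting_time g (Num.max (u n) 0) <= hitting_time g x.
  rewrite leNgt; apply/negP.
  move=> /(lt_hitting_time cg g0 (max0 _) (hg _ (max0 _)) (hitting_time_ge0 _ _)).
  have := running_max_ge cg (u := hitting_time g x) (v := hitting_time g x).
  rewrite hitting_time_ge0 lexx hitting_timeE//; last exact: hg.
  move=> /(_ isT) h1 h2; have := le_lt_trans h1 h2.
  by rewrite ltNge ge_max x0 ltW.
have [Te|Te] := ltP (hitting_time g x) e.
  near=> n; rewrite ger0_norm ?subr_ge0//.
  by apply: le_lt_trans Te; rewrite lerBlDr lerDl hitting_time_ge0.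
pose s := hitting_time g x - e / 2.
have s0 : 0 <= s by rewrite subr_ge0 (le_trans _ Te)// ler_piMr ?ltW// invf_lt1// ltr1n.
have sT : s < hitting_time g x by rewrite gtrBl divr_gt0.
have Mx : running_max g s < x by apply/lt_hitting_time => //; exact: hg.
near=> n; rewrite ger0_norm ?subr_ge0//.
have : s < hitting_time g (Num.max (u n) 0).
  apply/lt_hitting_time => //; first exact: hg.
  rewrite lt_max; apply/orP; left.
  near: n; exact: (cvgr_gt _ cu).
rewrite /s ltrBlDr -ltrBlDl => /lt_le_trans; apply.
by rewrite ler_piMr ?ltW// invf_lt1// ltr1n.
Unshelve. all: by end_near.
Qed.

End continuous_paths.

(** * The stopped exponential martingale *)

(* The first [i h] at which the running maximum has reached [x], capped at
   [n h]. *)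
Fixpoint grid_hitting_time (R : realType) (h x : R) (g : R -> R) (n : nat) : R :=
  if n is m.+1 then
    if running_max g (m%:R * h) < x then m.+1%:R * h
    else grid_hitting_time h x g m
  else 0.

Section grid_hitting_time_theory.
Context (R : realType) (h x : R) (g : R -> R).
Hypotheses (h0 : 0 < h) (x0 : 0 < x) (cg : continuous g) (g0 : g 0 = 0).

Lemma grid_hitting_time_itv n : 0 <= grid_hitting_time h x g n <= n%:R * h.
Proof.
have nh (m : nat) : 0 <= m%:R * h by rewrite mulr_ge0// ltW.
elim: n => [|n IH] /=; first by rewrite mul0r lexx.
case: ifPn => _; first by rewrite lexx nh.
have /andP[-> t1] := IH; rewrite (le_trans t1)//= ler_pM2r//.
by rewrite ler_nat.
Qed.

Lemma grid_hitting_time_below n :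
  running_max g (n%:R * h) < x -> grid_hitting_time h x g n = n%:R * h.
Proof.
case: n => [|n] /= Mn; first by rewrite mul0r.
rewrite ifT//; apply: le_lt_trans Mn; apply: running_max_le => //.
by rewrite mulr_ge0 ?(ltW h0)//= ler_pM2r// ler_nat.
Qed.

Lemma grid_hitting_time_above n : x <= running_max g (n%:R * h) ->
  hits g x /\ hitting_time g x <= grid_hitting_time h x g n <= hitting_time g x + h.
Proof.
have nh (m : nat) : 0 <= m%:R * h by rewrite mulr_ge0// ltW.
elim: n => [|n IH] /=.
  have [c /le_anti c0 gc] := running_max_attained cg (lexx 0).
  by rewrite mul0r -gc -c0 g0 leNgt x0.
move=> xM; case: ifPn => [Mx|]; last by rewrite -leNgt.
have hx : hits g x.
  have [c /andP[c0 cn] gc] := running_max_attained cg (nh n.+1).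
  rewrite -gc in xM.
  have cgc : {within `[0, c], continuous g} by exact: continuous_subspaceT.
  have [|v] := @IVT _ g 0 c x c0 cgc.
    by rewrite g0 ge_min (ltW x0) le_max xM orbT.
  by rewrite in_itv/= => /andP[v0 vc] gv; exists v.
split => //; apply/andP; split.
  rewrite leNgt; apply/negP => /(lt_hitting_time cg g0 (ltW x0) hx (nh _)).
  by rewrite ltNge xM.
move/(lt_hitting_time cg g0 (ltW x0) hx (nh _)) : Mx => /ltW.
by rewrite -natr1 mulrDl mul1r lerD2r.
Qed.

End grid_hitting_time_theory.

Section brownian.
Context d (T : measurableType d) (R : realType) (P : probability T R).
Variable B : R -> {RV P >-> R}.
Hypothesis BM : standard_brownian_motion P B.

(* Frozen at its initial value on negative times, to be continuous on [R]. *)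
Definition bm_path w (t : R) : R := B (Num.max t 0) w.

Lemma bm_pathE w t : 0 <= t -> bm_path w t = B t w.
Proof. by move=> t0; rewrite /bm_path max_l. Qed.

Lemma bm_path0 w : bm_path w 0 = 0.
Proof. by rewrite bm_pathE// (bm_start BM). Qed.

Lemma continuous_bm_path w : continuous (bm_path w).
Proof.
move=> t; have := @bm_continuous _ _ _ _ _ BM w; move/subspace_continuousP.
have max0 (y : R) : `[0, +oo[%classic (Num.max y 0).
  by rewrite /= in_itv/= andbT le_max lexx orbT.
move=> /(_ (Num.max t 0) (max0 t)) H.
apply: (@cvg_comp _ _ _ (fun y => Num.max y 0) (fun y => B y w) _
   (within `[0, +oo[ (nbhs (Num.max t 0)))); last exact: H.
move=> A; rewrite /within/= => nA.
have cmax : (fun y : R => Num.max y 0) @ t --> Num.max t 0.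
  by apply: continuous_max; [exact: cvg_id|exact: cvg_cst].
by apply: (@filterS _ (nbhs t) _ _ _ _ (cmax _ nA)) => y /(_ (max0 y)).
Qed.

Lemma first_passage_timeE x w :
  first_passage_time (fun s => B s) x w = hitting_time (bm_path w) x.
Proof.
congr inf; apply/seteqP; split => s /= [s0 sx]; split => //.
  by rewrite bm_pathE.
by rewrite -bm_pathE.
Qed.

(* [T] with the sigma-algebra generated by [B] at the times of [D]. *)
Definition past (D : set R) : measurableType _ := g_sigma_algebraType
  (\bigcup_(u in D) preimage_set_system setT (fun w => B u w) measurable).

Lemma past_measurable D A : process_sigma_algebra D B A -> measurable A.
Proof.
apply: smallest_sub; first exact: sigma_algebra_measurable.
move=> C [u _ [Y mY <-]]; exact: (measurable_funP (B u)).
Qed.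

Lemma measurable_past D u : D u ->
  measurable_fun setT (fun w : past D => B u w).
Proof.
move=> Du _ Y mY; apply: sub_sigma_algebra; exists u => //.
by exists Y.
Qed.

Lemma measurable_running_max_past D u : `[0, u] `<=` D -> 0 <= u ->
  measurable_fun setT (fun w : past D => running_max (bm_path w) u).
Proof.
move=> uD u0; apply: (measurability _ (RGenOInfty.measurableE R)) => //.
move=> _ [_ [y ->] <-]; rewrite setTI.
have -> : (fun w => running_max (bm_path w) u) @^-1` `]y, +oo[ =
    ~` \bigcap_n \bigcap_(i in [set i : nat | (i <= n.+1)%N])
      [set w : past D | B (u * (i%:R / n.+1%:R)) w <= y].
  have uni n i : 0 <= u * (i%:R / n.+1%:R) :> R by rewrite mulr_ge0 ?divr_ge0.
  apply/seteqP; split => w /=.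
    rewrite in_itv/= andbT => yM H; move: yM; apply/negP; rewrite -leNgt.
    apply/running_max_grid => //; first exact: continuous_bm_path.
    by move=> n i ni; rewrite bm_pathE; [exact: H|exact: uni].
  move=> H; rewrite in_itv/= andbT ltNge; apply/negP => Mu; apply: H.
  move=> n _ i /= ni; rewrite -bm_pathE; last exact: uni.
  by apply: (running_max_grid _ (@continuous_bm_path w) u0).1 Mu _ _ ni.
apply: measurableC; apply: bigcapT_measurable => n.
apply: bigcap_measurable => //; first by exists 0%N.
move=> i /= ni; rewrite -[X in measurable X]setTI.
have mB : measurable_fun setT (fun w : past D => B (u * (i%:R / n.+1%:R)) w).
  apply: measurable_past; apply: uD; rewrite /= in_itv/=.
  rewrite mulr_ge0 ?divr_ge0//= ler_piMr// ler_pdivrMr ?ltr0n//.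
  by rewrite mul1r ler_nat.
rewrite (_ : [set w | _] =
  (fun w : past D => B (u * (i%:R / n.+1%:R)) w) @^-1` `]-oo, y]).
  exact: mB.
by apply/seteqP; split => w /=; rewrite in_itv.
Qed.

Lemma running_max_lt_past D u x : `[0, u] `<=` D -> 0 <= u ->
  process_sigma_algebra D B [set w | running_max (bm_path w) u < x].
Proof.
move=> uD u0.
have := measurable_running_max_past uD u0 measurableT (measurable_itv `]-oo, x[).
rewrite setTI; congr (_ _); apply/seteqP; split => w /=; by rewrite in_itv.
Qed.

Lemma measurable_running_max u : 0 <= u ->
  measurable_fun setT (fun w => running_max (bm_path w) u).
Proof.
move=> u0 _ Y mY.
have := measurable_running_max_past (@subset_refl _ _) u0 measurableT mY.
exact: past_measurable.
Qed.

Definition exp_mart (a t : R) w := expR (a * bm_path w t - a ^+ 2 / 2 * t).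

Let em_ge0 a t w : 0 <= exp_mart a t w.
Proof. exact: expR_ge0. Qed.

Lemma measurable_exp_mart a t : measurable_fun setT (exp_mart a t).
Proof.
apply: measurableT_comp => //; apply: measurable_funB => //.
by apply: measurable_funM => //; exact: measurable_funP.
Qed.

Lemma integral_exp_increment a u v : 0 <= u -> u < v ->
  (\int[P]_w (expR (a * (B v w - B u w) - a ^+ 2 / 2 * (v - u)))%:E = 1)%E.
Proof.
move=> u0 uv; have uv0 : 0 < v - u by rewrite subr_gt0.
have mI : @measurable_fun _ _ T (measurableTypeR R) setT (fun w => B v w - B u w).
  by apply: measurable_funB; exact: measurable_funP.
pose I : {mfun T >-> measurableTypeR R} :=
  HB.pack (fun w => B v w - B u w) (isMeasurableFun.Build _ _ _ _ _ mI).
have me : measurable_fun (setT : set (measurableTypeR R))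
    (EFin \o (fun y : R => expR (a * y))).
  by apply/measurable_EFinP; apply: measurableT_comp => //; apply: measurable_funM.
under eq_integral do rewrite expRD mulrC EFinM.
rewrite ge0_integralZl//; last first.
  by apply/measurable_EFinP; apply: measurableT_comp => //; apply: measurable_funM.
have -> : (\int[P]_w (expR (a * (B v w - B u w)))%:E =
           \int[distribution P I]_y (expR (a * y))%:E)%E.
  by rewrite (ge0_integral_distribution I me)// => y; rewrite lee_fin expR_ge0.
have -> : (\int[distribution P I]_y (expR (a * y))%:E =
           \int[normal_prob 0 (Num.sqrt (v - u))]_y (expR (a * y))%:E)%E.
  apply: eq_measure_integral => A mA _.
  exact: bm_increment_normal BM _ _ _ u0 uv mA.
rewrite normal_prob_mgf; last by rewrite gt_eqF// sqrtr_gt0.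
rewrite sqr_sqrtr ?ltW// -EFinM -expRD.
by rewrite [X in expR X](_ : _ = 0) ?expR0//; ring.
Qed.

Lemma exp_mart_increment a u v A : 0 <= u -> u < v ->
  process_sigma_algebra `[0, u] B A ->
  (\int[P]_(w in A) (exp_mart a v w)%:E = \int[P]_(w in A) (exp_mart a u w)%:E)%E.
Proof.
move=> u0 uv FA; have v0 : 0 <= v by rewrite (le_trans u0) ?ltW.
have mA : measurable A by exact: past_measurable FA.
pose f w := \1_A w * exp_mart a u w.
pose g w := expR (a * (B v w - B u w) - a ^+ 2 / 2 * (v - u)).
have intA t : (\int[P]_(w in A) (exp_mart a t w)%:E =
               \int[P]_w (\1_A w * exp_mart a t w)%:E)%E.
  rewrite integral_mkcond; apply: eq_integral => w _.
  by rewrite patchE indicE; case: ifPn => _; rewrite ?mul1r ?mul0r.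
have fpast : measurable_fun setT (f : past `[0, u] -> R).
  apply: measurable_funM; first exact: measurable_indic.
  apply: measurableT_comp => //; apply: measurable_funB => //.
  apply: measurable_funM => //; rewrite /bm_path max_l//.
  by apply: measurable_past; rewrite /= in_itv/= u0 lexx.
have mh : measurable_fun setT (fun y : R => expR (a * y - a ^+ 2 / 2 * (v - u))).
  by apply: measurableT_comp => //; apply: measurable_funB => //; apply: measurable_funM.
rewrite !intA.
transitivity (\int[P]_w (f w * g w)%:E)%E.
  apply: eq_integral => w _; rewrite /f /g /exp_mart !bm_pathE//.
  by congr (_%:E); rewrite -[RHS]mulrA -expRD; congr (_ * expR _); ring.
rewrite integral_indep_mul.
- by rewrite integral_exp_increment// mule1.
- apply: measurable_funM; first exact: measurable_indic.
  exact: measurable_exp_mart.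
- by apply: (measurableT_comp mh); apply: measurable_funB; exact: measurable_funP.
- by move=> w; rewrite mulr_ge0.
- by move=> w; exact: expR_ge0.
move=> S S' mS mS'.
have := bm_increment_indep BM u0 uv (fpast measurableT _ mS) (mh measurableT _ mS').
by rewrite !setTI.
Qed.

Definition stopped_mart a h x n w := exp_mart a (grid_hitting_time h x (bm_path w) n) w.

Lemma measurable_stopped_mart a h x n : 0 < h ->
  measurable_fun setT (stopped_mart a h x n).
Proof.
move=> h0; elim: n => [|n IH]; first exact: measurable_exp_mart.
rewrite (_ : stopped_mart _ _ _ _ = fun w =>
  if running_max (bm_path w) (n%:R * h) < x then exp_mart a (n.+1%:R * h) w
  else stopped_mart a h x n w).
  apply: measurable_fun_ifT => //; last exact: measurable_exp_mart.
  apply: measurable_fun_ltr => //; apply: measurable_running_max.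
  by rewrite mulr_ge0// ltW.
by apply/funext => w; rewrite /stopped_mart/=; case: ifP.
Qed.

(* On the event that [x] is not reached by time [n h], the stopped time passes
   from [n h] to [n.+1 h]; off this event it does not move. *)
Lemma integral_stopped_mart a h x n : 0 < h -> 0 < x ->
  (\int[P]_w (stopped_mart a h x n w)%:E = 1)%E.
Proof.
move=> h0 x0; have nh (m : nat) : 0 <= m%:R * h by rewrite mulr_ge0// ltW.
elim: n => [|n <-].
  under eq_integral do rewrite /stopped_mart/= /exp_mart bm_path0 !mulr0 subr0 expR0.
  by rewrite integral_cst// mul1e; exact: probability_setT.
pose A := [set w | running_max (bm_path w) (n%:R * h) < x].
have FA : process_sigma_algebra `[0, n%:R * h] B A by exact: running_max_lt_past.
have mA : measurable A by exact: past_measurable FA.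
have mAC : measurable (~` A) by exact: measurableC.
have split k : (\int[P]_w (stopped_mart a h x k w)%:E =
  \int[P]_(w in A) (stopped_mart a h x k w)%:E +
  \int[P]_(w in ~` A) (stopped_mart a h x k w)%:E)%E.
  rewrite -ge0_integral_setU//; last 3 first.
  - by apply/measurable_EFinP; apply: measurable_funTS; exact: measurable_stopped_mart.
  - by move=> w _; rewrite lee_fin; exact: em_ge0.
  - by apply/disj_set2P; rewrite setICr.
  by rewrite setUv.
rewrite !split; congr (_ + _)%E.
  transitivity (\int[P]_(w in A) (exp_mart a (n.+1%:R * h) w)%:E)%E.
    by apply: eq_integral => w; rewrite inE /A/= /stopped_mart/= => ->.
  rewrite (exp_mart_increment a (nh n) _ FA); last by rewrite ltr_pM2r// ltr_nat.
  apply: eq_integral => w; rewrite inE /A/= /stopped_mart => Mx.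
  by rewrite grid_hitting_time_below//; exact: continuous_bm_path.
apply: eq_integral => w; rewrite inE /A/= /stopped_mart/= => /negP Mx.
by rewrite (negbTE Mx).
Qed.

Lemma integral_stopped_mart_sqr a h x n : 0 < h -> 0 < x ->
  (\int[P]_w (stopped_mart a h x n w ^+ 2)%:E <= (expR (a ^+ 2 * (n%:R * h)))%:E)%E.
Proof.
move=> h0 x0; have mS := measurable_stopped_mart.
rewrite -[leRHS]mule1 -(integral_stopped_mart (2 * a) n h0 x0).
rewrite -ge0_integralZl//; last 2 first.
- by apply/measurable_EFinP; exact: mS.
- by move=> w _; rewrite lee_fin; exact: em_ge0.
apply: ge0_le_integral => //.
- by move=> w _; rewrite lee_fin exprn_even_ge0.
- by apply/measurable_EFinP; apply: measurable_funX; exact: mS.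
- by apply: emeasurable_funM => //; apply/measurable_EFinP; exact: mS.
move=> w _; rewrite -EFinM lee_fin /stopped_mart /exp_mart -expRM_natl -expRD ler_expR.
have /andP[t0 t1] := grid_hitting_time_itv x (bm_path w) h0 n.
have := ler_wpM2l (sqr_ge0 a) t1.
set t := grid_hitting_time _ _ _ _; set b := bm_path w t.
lra.
Qed.

End brownian.

(** * Laplace transform of Brownian hitting times *)

Section measurable_hitting_time.
Context d (S : measurableType d) (R : realType) (g : S -> R -> R).
Hypotheses (cg : forall w, continuous (g w)) (g0 : forall w, g w 0 = 0).
Hypothesis mg : forall u, 0 <= u ->
  measurable_fun setT (fun w => running_max (g w) u).

Lemma measurable_hits (Y : S -> R) : measurable_fun setT Y ->
  (forall w, 0 <= Y w) -> measurable [set w | hits (g w) (Y w)].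
Proof.
move=> mY Y0.
have -> : [set w | hits (g w) (Y w)] =
    \bigcup_(K : nat) [set w | Y w <= running_max (g w) K%:R].
  apply/seteqP; split => w /=.
    by move=> /(hits_running_max (@cg w) (g0 w) (Y0 w))[K HK]; exists K.
  by move=> [K _ HK]; apply/hits_running_max => //; exists K.
apply: bigcupT_measurable => K; rewrite -[X in measurable X]setTI.
by apply: measurable_fun_ler => //; exact: mg.
Qed.

Lemma measurable_hitting_time (Y : S -> R) : measurable_fun setT Y ->
  (forall w, 0 <= Y w) -> measurable_fun setT (fun w => hitting_time (g w) (Y w)).
Proof.
move=> mY Y0; apply: (measurability _ (RGenOInfty.measurableE R)) => //.
move=> _ [_ [y ->] <-]; rewrite setTI.
have [y0|y0] := ltP y 0.
  rewrite (_ : _ @^-1` _ = setT)//; apply/seteqP; split => // w _ /=.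
  by rewrite in_itv/= andbT (lt_le_trans y0)// hitting_time_ge0.
have -> : (fun w => hitting_time (g w) (Y w)) @^-1` `]y, +oo[ =
    [set w | running_max (g w) y < Y w] `&` [set w | hits (g w) (Y w)].
  apply/seteqP; split => w /=; rewrite in_itv/= andbT.
    move=> yT; have hY : hits (g w) (Y w).
      apply: contrapT => nh; move: yT; apply/negP; rewrite -leNgt.
      rewrite /hitting_time (_ : [set _ | _] = set0) ?inf0// -subset0 => s [s0 gs].
      by apply: nh; exists s.
    by split => //; apply/(lt_hitting_time (@cg w) (g0 w) (Y0 w) hY y0).
  by move=> [My hY]; apply/(lt_hitting_time (@cg w) (g0 w) (Y0 w) hY y0).
apply: measurableI; last exact: measurable_hits.
rewrite -[X in measurable X]setTI.
by apply: measurable_fun_ltr => //; exact: mg.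
Qed.

End measurable_hitting_time.

Section brownian_hitting_time.
Context d (T : measurableType d) (R : realType) (P : probability T R).
Variable B : R -> {RV P >-> R}.
Hypothesis BM : standard_brownian_motion P B.

Let cp w : continuous (bm_path B w) := @continuous_bm_path _ _ _ _ _ BM w.
Let p0 w : bm_path B w 0 = 0 := bm_path0 BM w.
Let mM := @measurable_running_max _ _ _ _ _ BM.

Let stop (s x : R) w : R :=
  if running_max (bm_path B w) s < x then s else hitting_time (bm_path B w) x.

Let stop_cvg (s x : R) w : 0 < s -> 0 < x ->
  grid_hitting_time (s / m.+1%:R) x (bm_path B w) m.+1 @[m --> \oo] --> stop s x w.
Proof.
move=> s0 x0; apply: (@squeeze_cvgr _ _ _ _ (fun=> stop s x w)
  (fun m => stop s x w + s * harmonic m)).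
- apply: nearW => m.
  have h0 : 0 < s / m.+1%:R by rewrite divr_gt0.
  have sE : m.+1%:R * (s / m.+1%:R) = s.
    by rewrite mulrC divfK// pnatr_eq0.
  rewrite /stop; case: ifPn => Ms.
    rewrite grid_hitting_time_below ?sE// lexx lerDl mulr_ge0 ?(ltW s0)//.
    by rewrite /harmonic/= invr_ge0.
  rewrite -leNgt -{1}sE in Ms.
  by have [_] := grid_hitting_time_above h0 x0 (@cp w) (p0 w) Ms.
- exact: cvg_cst.
- rewrite -[X in _ --> X]addr0 -[X in _ + X](mulr0 s).
  by apply: cvgD; [exact: cvg_cst|apply: cvgM; [exact: cvg_cst|exact: cvg_harmonic]].
Qed.

Let continuous_exp_mart (a : R) w : continuous (fun t => exp_mart B a t w).
Proof.
move=> t; apply: continuous_cvg; first exact: continuous_expR.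
by apply: cvgB; apply: cvgM; [exact: cvg_cst|exact: cp|exact: cvg_cst|exact: cvg_id].
Qed.

Let stopped_cvg (a s x : R) w : 0 < s -> 0 < x ->
  stopped_mart B a (s / m.+1%:R) x m.+1 w @[m --> \oo] --> exp_mart B a (stop s x w) w.
Proof.
move=> s0 x0.
exact: (@continuous_cvg _ _ _ \oo _ _ (fun t => exp_mart B a t w) _
  (@continuous_exp_mart a w _) (@stop_cvg s x w s0 x0)).
Qed.

Let mstopped (a s x : R) : 0 < s -> 0 < x ->
  measurable_fun setT (fun w => exp_mart B a (stop s x w) w).
Proof.
move=> s0 x0; apply: (@measurable_fun_cvg _ _ _ _
  (fun m => stopped_mart B a (s / m.+1%:R) x m.+1)).
  by move=> m; apply: measurable_stopped_mart => //; rewrite divr_gt0.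
by move=> w _; exact: stopped_cvg.
Qed.

Let stopped_le (a s x : R) w : 0 < a -> 0 < s -> 0 < x ->
  exp_mart B a (stop s x w) w <= expR (a * x - a ^+ 2 / 2 * stop s x w).
Proof.
move=> a0 s0 x0; rewrite /exp_mart ler_expR lerB// ler_wpM2l ?(ltW a0)//.
rewrite /stop; case: ifPn => Ms.
  by apply/ltW/(le_lt_trans _ Ms)/running_max_ge => //; rewrite lexx ltW.
rewrite -leNgt in Ms; rewrite hitting_timeE//.
have [c /andP[c0 cs] gc] := running_max_attained (@cp w) (ltW s0).
apply/hits_running_max => //; first exact: ltW.
exists (Num.truncn s).+1; rewrite (le_trans Ms)// running_max_le// ltW//=.
by rewrite ltW// truncnS_gt.
Qed.

Let stop_ge0 (s x : R) w : 0 < s -> 0 <= stop s x w.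
Proof.
by move=> s0; rewrite /stop; case: ifP => _; [exact: ltW|exact: hitting_time_ge0].
Qed.

Let stopped_le_expR (a s x : R) w : 0 < a -> 0 < s -> 0 < x ->
  exp_mart B a (stop s x w) w <= expR (a * x).
Proof.
move=> a0 s0 x0; rewrite (le_trans (stopped_le w a0 s0 x0))// ler_expR gerBl.
by rewrite mulr_ge0 ?stop_ge0// divr_ge0// sqr_ge0.
Qed.

(* The grid stopping times overshoot [x], so the limit is taken after truncation
   at [C]; the second-moment bound makes the error [K / C] uniform in the mesh. *)
Let integral_stop (a s x : R) : 0 < a -> 0 < s -> 0 < x ->
  (\int[P]_w (exp_mart B a (stop s x w) w)%:E = 1)%E.
Proof.
move=> a0 s0 x0; set I := (\int[P]_w _)%E.
have h0 m : 0 < s / m.+1%:R by rewrite divr_gt0.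
pose Z m := stopped_mart B a (s / m.+1%:R) x m.+1.
have mZ m : measurable_fun setT (Z m) by exact: measurable_stopped_mart.
have Z0 m w : 0 <= Z m w by exact: expR_ge0.
pose K := expR (a ^+ 2 * s).
have bound C : expR (a * x) <= C -> (1 - (K / C)%:E <= I <= 1)%E.
  move=> aC; have C0 : 0 < C by apply: lt_le_trans aC; exact: expR_gt0.
  have mC m : measurable_fun setT (fun w => Num.min (Z m w) C).
    exact: measurable_minr.
  have cvgI : (\int[P]_w (Num.min (Z m w) C)%:E @[m --> \oo] --> I)%E.
    have -> : I = (\int[P]_w (Num.min (exp_mart B a (stop s x w) w) C)%:E)%E.
      apply: eq_integral => w _; rewrite min_l//.
      by rewrite (le_trans _ aC)// stopped_le_expR.
    apply: (@bounded_convergence _ _ _ _ _ _ _ C) => //.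
    - by apply: measurable_minr => //; exact: mstopped.
    - by move=> m w; rewrite le_min Z0 (ltW C0)/= ge_min lexx orbT.
    - apply: aeW => w.
      apply: (@continuous_cvg _ _ _ \oo _ (fun m => Z m w) (fun z : R => Num.min z C)
        (exp_mart B a (stop s x w) w)); last exact: stopped_cvg.
      by apply: continuous_min; [exact: cvg_id|exact: cvg_cst].
  have le1 m : (\int[P]_w (Num.min (Z m w) C)%:E <= 1)%E.
    rewrite -(integral_stopped_mart BM a m.+1 (h0 m) x0).
    apply: ge0_le_integral => //.
    - by move=> w _; rewrite lee_fin le_min Z0 ltW.
    - exact/measurable_EFinP.
    - exact/measurable_EFinP/mZ.
    - by move=> w _; rewrite lee_fin ge_min lexx.
  have ge1 m : (1 - (K / C)%:E <= \int[P]_w (Num.min (Z m w) C)%:E)%E.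
    rewrite leeBlDr// -(integral_stopped_mart BM a m.+1 (h0 m) x0).
    apply: (@le_trans _ _ (\int[P]_w ((Num.min (Z m w) C)%:E +
        (C^-1)%:E * (Z m w ^+ 2)%:E))%E).
      apply: ge0_le_integral => //.
      - by move=> w _; rewrite lee_fin; exact: Z0.
      - exact/measurable_EFinP/mZ.
      - apply: emeasurable_funD; first by apply/measurable_EFinP; exact: mC.
        apply: emeasurable_funM => //; apply/measurable_EFinP.
        by apply: measurable_funX; exact: mZ.
      move=> w _; rewrite -EFinM -EFinD lee_fin -/(Z m w).
      have [ZC|ZC] := leP (Z m w) C.
        by rewrite lerDl mulr_ge0 ?sqr_ge0// invr_ge0 ltW.
      apply: (@le_trans _ _ (C^-1 * Z m w ^+ 2)); last by rewrite lerDr ltW.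
      by rewrite mulrC ler_pdivlMr// expr2 ler_wpM2l// ltW.
    rewrite ge0_integralD//; last 4 first.
    - by move=> w _; rewrite lee_fin le_min Z0 ltW.
    - exact/measurable_EFinP.
    - by move=> w _; rewrite -EFinM lee_fin mulr_ge0 ?sqr_ge0// invr_ge0 ltW.
    - apply: emeasurable_funM => //; apply/measurable_EFinP.
      by apply: measurable_funX; exact: mZ.
    rewrite leeD2l// ge0_integralZl//; last 3 first.
    - by apply/measurable_EFinP; apply: measurable_funX; exact: mZ.
    - by move=> w _; rewrite lee_fin sqr_ge0.
    - by rewrite lee_fin invr_ge0 ltW.
    rewrite mulrC EFinM lee_wpmul2l ?lee_fin ?invr_ge0 ?(ltW C0)//.
    have := integral_stopped_mart_sqr BM a m.+1 (h0 m) x0.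
    by rewrite (_ : m.+1%:R * _ = s)// mulrC divfK// pnatr_eq0.
  apply/andP; split.
    rewrite -(cvg_lim _ cvgI)//; apply: lime_ge.
      by apply/cvg_ex; eexists; exact: cvgI.
    exact: nearW.
  rewrite -(cvg_lim _ cvgI)//; apply: lime_le.
    by apply/cvg_ex; eexists; exact: cvgI.
  exact: nearW.
have /andP[_ I1] := bound _ (lexx _).
apply/eqP; rewrite eq_le I1 /=; apply/lee_addgt0Pr => e e0.
pose C := Num.max (expR (a * x)) (K / e).
have aC : expR (a * x) <= C by rewrite le_max lexx.
have C0 : 0 < C by apply: lt_le_trans aC; exact: expR_gt0.
have /andP[+ _] := bound C aC; rewrite leeBlDr// => /le_trans; apply.
rewrite leeD2l// lee_fin ler_pdivrMr// mulrC -ler_pdivrMr//.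
by rewrite /C le_max lexx orbT.
Qed.

Lemma measurable_bm_hitting_time (x : R) : 0 <= x ->
  measurable_fun setT (fun w => hitting_time (bm_path B w) x).
Proof.
move=> x0; apply: (@measurable_hitting_time _ _ _ (bm_path B) cp p0 mM (cst x)) => //.
Qed.

Lemma measurable_bm_hits (x : R) : 0 <= x -> measurable [set w | hits (bm_path B w) x].
Proof.
move=> x0; apply: (@measurable_hits _ _ _ (bm_path B) cp p0 mM (cst x)) => //.
Qed.

Let laplace (a x : R) w : R :=
  \1_[set w | hits (bm_path B w) x] w *
  expR (- (a ^+ 2 / 2 * hitting_time (bm_path B w) x)).

Let mlaplace (a x : R) : 0 <= x -> measurable_fun setT (laplace a x).
Proof.
move=> x0; apply: measurable_funM.
  by apply: measurable_indic; exact: measurable_bm_hits.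
apply: measurableT_comp => //; apply: measurableT_comp => //.
by apply: measurable_funM => //; exact: measurable_bm_hitting_time.
Qed.

Let integral_laplace (a x : R) : 0 < a -> 0 < x ->
  (\int[P]_w (laplace a x w)%:E = (expR (- (a * x)))%:E)%E.
Proof.
move=> a0 x0.
have mL := mlaplace a (ltW x0).
have cvgL : (\int[P]_w (exp_mart B a (stop n.+1%:R x w) w)%:E @[n --> \oo] -->
    \int[P]_w (expR (a * x) * laplace a x w)%:E)%E.
  apply: (@bounded_convergence _ _ _ _ _ _ _ (expR (a * x))) => //.
  - by move=> n; exact: mstopped.
  - exact: measurable_funM.
  - by move=> n w; rewrite expR_ge0 stopped_le_expR.
  apply: aeW => w; rewrite /laplace indicE.
  have [hx|nhx] := pselect (hits (bm_path B w) x).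
    rewrite mem_set// mul1r -expRD; apply: cvg_near_cst.
    have [K HK] := (hits_running_max (@cp w) (p0 w) (ltW x0)).1 hx.
    near=> n; rewrite /stop ifF.
      by rewrite /exp_mart hitting_timeE.
    apply/negbTE; rewrite -leNgt (le_trans HK)// running_max_le// ler0n/= ler_nat.
    by rewrite leqW//; near: n; exact: nbhs_infty_ge.
  rewrite memNset// mul0r mulr0.
  have Mx (n : nat) : running_max (bm_path B w) n%:R < x.
    rewrite ltNge; apply/negP => xM; apply: nhx.
    by apply/hits_running_max => //; [exact: ltW|exists n].
  pose c := expR (a * x) * (a ^+ 2 / 2)^-1.
  have a2 : 0 < a ^+ 2 / 2 by rewrite divr_gt0// exprn_gt0.
  apply: (@squeeze_cvgr _ _ _ _ (fun=> 0) (fun n => c * harmonic n)).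
  - apply: nearW => n; rewrite expR_ge0/=.
    have n0 : 0 < n.+1%:R :> R by [].
    apply: le_trans (stopped_le w a0 n0 x0) _.
    rewrite /stop Mx expRD /c -[leRHS]mulrA ler_pM2l ?expR_gt0//.
    rewrite expRN -invfM lef_pV2 ?posrE ?expR_gt0 ?mulr_gt0//.
    by rewrite (le_trans _ (expR_ge1Dx _))// lerDr.
  - exact: cvg_cst.
  - rewrite -[X in _ --> X](mulr0 c).
    by apply: cvgM; [exact: cvg_cst|exact: cvg_harmonic].
have : (\int[P]_w (expR (a * x) * laplace a x w)%:E = 1)%E.
  apply: (cvg_unique _ cvgL) => //.
  rewrite (_ : (fun n => _) = fun=> 1%E); first exact: cvg_cst.
  by apply/funext => n; rewrite integral_stop.
under eq_integral do rewrite EFinM.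
rewrite ge0_integralZl//; last 2 first.
- exact/measurable_EFinP.
- by move=> w _; rewrite lee_fin mulr_ge0 ?expR_ge0.
move=> E; rewrite -[LHS]mul1e.
rewrite (_ : 1%E = (expR (- (a * x)) * expR (a * x))%:E); last first.
  by rewrite -expRD addNr expR0.
by rewrite EFinM -muleA E mule1.
Unshelve. all: by end_near.
Qed.

(* Let [a] tend to 0 in [integral_laplace]. *)
Lemma probability_hits (x : R) : 0 <= x -> P [set w | hits (bm_path B w) x] = 1%E.
Proof.
rewrite le_eqVlt => /orP[/eqP <-|x0].
  rewrite (_ : [set _ | _] = setT) ?probability_setT//.
  by apply/seteqP; split => // w _; exists 0.
apply/eqP; rewrite eq_le probability_le1/=; last exact: measurable_bm_hits (ltW x0).
apply/lee_addgt0Pr => e e0.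
have ex : 0 < e / x by rewrite divr_gt0.
apply: (@le_trans _ _ ((expR (- (e / x * x)))%:E + e%:E)%E).
  rewrite -EFinD lee_fin -lerBlDr (le_trans _ (expR_ge1Dx _))//.
  by rewrite divfK// gt_eqF.
rewrite leeD2r// -integral_laplace//.
have mh := measurable_bm_hits (ltW x0).
have -> : (P [set w | hits (bm_path B w) x] =
    \int[P]_w (\1_[set w | hits (bm_path B w) x] w)%:E)%E.
  by rewrite integral_indic// setIT.
apply: ge0_le_integral => //.
- by move=> w _; rewrite lee_fin mulr_ge0 ?expR_ge0.
- exact/measurable_EFinP/mlaplace/ltW.
- by apply/measurable_EFinP; exact: measurable_indic.
move=> w _; rewrite lee_fin /laplace ler_piMr// -expR0 ler_expR oppr_le0.
by rewrite mulr_ge0 ?hitting_time_ge0// divr_ge0// sqr_ge0.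
Qed.

Lemma hits_ae : {ae P, forall w, forall x, 0 <= x -> hits (bm_path B w) x}.
Proof.
have : {ae P, forall w, forall n : nat, hits (bm_path B w) n%:R}.
  apply: ae_foralln => n; exists (~` [set w | hits (bm_path B w) n%:R]).
  have mh := measurable_bm_hits (ler0n R n); split => //.
    exact: measurableC.
  apply: etrans (probability_setC P mh) _.
  by rewrite probability_hits// subee.
apply: filterS => w H x x0.
have [K HK] := (hits_running_max (@cp w) (p0 w) (ler0n _ _)).1 (H (Num.truncn x).+1).
apply/hits_running_max => //; exists K; apply: le_trans HK.
by rewrite ltW// truncnS_gt.
Qed.

Lemma integral_exp_hitting_time (l x : R) : 0 < l -> 0 <= x ->
  (\int[P]_w (expR (- (l * hitting_time (bm_path B w) x)))%:E =
   (expR (- (x * Num.sqrt (2 * l))))%:E)%E.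
Proof.
move=> l0; rewrite le_eqVlt => /orP[/eqP <-|x0].
  have T0 w : hitting_time (bm_path B w) 0 = 0.
    apply/eqP; rewrite eq_le hitting_time_ge0 andbT.
    by apply: ge_inf => //; exists 0 => s [].
  under eq_integral do rewrite T0 mulr0 oppr0 expR0.
  by rewrite mul0r oppr0 expR0 integral_cst// mul1e; exact: probability_setT.
have a0 : 0 < Num.sqrt (2 * l) by rewrite sqrtr_gt0 mulr_gt0.
have aE : Num.sqrt (2 * l) ^+ 2 / 2 = l.
  by rewrite sqr_sqrtr ?mulr_ge0 ?(ltW l0)// mulrAC mulfV ?mul1r.
rewrite mulrC -integral_laplace//; apply: ae_eq_integral => //.
- apply/measurable_EFinP; apply: measurableT_comp => //; apply: measurableT_comp => //.
  by apply: measurable_funM => //; exact: measurable_bm_hitting_time (ltW x0).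
- exact/measurable_EFinP/mlaplace/ltW.
apply: filterS hits_ae => w H _; rewrite /laplace aE indicE mem_set ?mul1r//=.
exact: H (ltW x0).
Qed.

End brownian_hitting_time.

(** * Iterated first-passage times *)

Section stable_exponent.
Context (R : realType).

Definition stable_exponent (m : nat) (l : R) : R :=
  l `^ (2 ^+ m)^-1 * 2 `^ (1 - (2 ^+ m)^-1).

Lemma stable_exponent0 l : 0 < l -> stable_exponent 0 l = l.
Proof.
move=> l0; rewrite /stable_exponent expr0 invr1 powRr1 ?ltW// subrr powRr0.
by rewrite mulr1.
Qed.

Lemma stable_exponentS m l : 0 < l ->
  stable_exponent m.+1 l = stable_exponent m (Num.sqrt (2 * l)).
Proof.
move=> l0; rewrite /stable_exponent -powR12_sqrt ?mulr_ge0 ?(ltW l0)//.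
rewrite -powRrM powRM ?(ltW l0)// ?ler0n//.
set a := (2 ^+ m.+1)^-1.

have -> : 2^-1 * (2 ^+ m)^-1 = a by rewrite /a exprS invfM.
have -> : (2 ^+ m)^-1 = 2 * a :> R.
  by rewrite /a exprS invfM mulrA mulfV ?mul1r.
rewrite [2 `^ a * _]mulrC -mulrA; congr (_ * _).
rewrite -powRD; last by rewrite pnatr_eq0 implybT.
by congr (_ `^ _); ring.
Qed.

End stable_exponent.

Section iterated_time.
Context (R : realType) (d : measure_display) (T : measurableType d).
Context (P : probability T R) (N : R -> {RV P >-> nat}) (n : nat).
Context (B : 'I_n -> R -> {RV P >-> R}).
Hypothesis B_brownian : forall j, standard_brownian_motion P (B j).
Hypothesis NB_indep : independent_processes P N (fun j t => B j t).
Context (t : R).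
Hypothesis t_gt0 : 0 < t.

Let F (o : option 'I_n) : set (set T) :=
  if o is Some j then process_sigma_algebra `[0, +oo[ (B j)
  else process_sigma_algebra `[0, +oo[ N.

Definition nested_time (s : seq 'I_n) (w : T) : R :=
  foldr (fun j x => first_passage_time (fun u => B j u) x w) t s.

Lemma nested_time_ge0 s w : 0 <= nested_time s w.
Proof.
case: s => [|j s]; first exact: ltW.
by rewrite /= first_passage_timeE hitting_time_ge0.
Qed.

Lemma nested_time_cons j s w :
  nested_time (j :: s) w = hitting_time (bm_path (B j) w) (nested_time s w).
Proof. by rewrite /= first_passage_timeE. Qed.

Lemma measurable_nested_time s : measurable_fun setT (nested_time s).
Proof.
elim: s => [|j s IH]; first exact: measurable_cst.
rewrite (_ : nested_time _ =
    fun w => hitting_time (bm_path (B j) w) (nested_time s w)); last first.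
  by apply/funext => w; exact: nested_time_cons.
apply: measurable_hitting_time => //.
- by move=> w; exact: continuous_bm_path (B_brownian j) w.
- exact: bm_path0.
- exact: measurable_running_max.
- exact: nested_time_ge0.
Qed.

Let F_measurable o A : F o A -> measurable A.
Proof.
case: o => [j|] /=; first exact: past_measurable.
apply: smallest_sub; first exact: sigma_algebra_measurable.
move=> C [u _ [Y mY <-]]; exact: (measurable_funP (N u)).
Qed.

Definition indep_of (Y : T -> R) (s : seq 'I_n) :=
  forall (J : {set option 'I_n}) (A : option 'I_n -> set T) (a : R),
  (forall j, j \in s -> Some j \notin J) ->
  (forall i, i \in J -> F i (A i)) ->
  P ((\bigcap_(i in [set` J]) A i) `&` [set w | a < Y w]) =
  (P (\bigcap_(i in [set` J]) A i) * P [set w | (a < Y w)%R])%E.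

Lemma indep_of_freeze Y s (J : {set option 'I_n}) A o (X : R -> T -> R) :
  indep_of Y s ->
  (forall j, j \in s -> Some j \notin J) -> (forall i, i \in J -> F i (A i)) ->
  o \notin J -> (forall j, j \in s -> Some j != o) ->
  (forall (u : R) (S : set R), measurable S -> F o (X u @^-1` S)) ->
  indep_freeze P (\bigcap_(i in [set` J]) A i) Y X.
Proof.
move=> iY sJ AF oJ so XF u a S mS.
pose A' i := if i == o then X u @^-1` S else A i.
have capE : \bigcap_(i in [set` o |: J]) A' i =
    (\bigcap_(i in [set` J]) A i) `&` X u @^-1` S.
  apply/seteqP; split => w /=.
    move=> H; split => [i iJ|].
      have := H i; rewrite /A' /= in_setU1 iJ orbT ifN; first exact.
      by apply: contraNN oJ => /eqP <-.
    by have := H o; rewrite /A' /= setU11 eqxx; apply.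
  move=> [H Xw] i /=; rewrite /A' in_setU1; case: eqVneq => //= _ iJ.
  exact: H.
have A'F i : i \in o |: J -> F i (A' i).
  rewrite /A' in_setU1; case: eqVneq => [-> _|_ /=]; [exact: XF|exact: AF].
rewrite setIAC -capE iY//; last first.
  by move=> j js; rewrite in_setU1 negb_or so// sJ.
rewrite (NB_indep A'F) (NB_indep AF) big_setU1//= {1}/A' eqxx.
have -> : (\prod_(i in J) P (A' i) = \prod_(i in J) P (A i))%E.
  apply: eq_bigr => i iJ; rewrite /A' ifN//.
  by apply: contraNN oJ => /eqP <-.
by rewrite [X in (X * _)%E = _]muleC muleAC.
Qed.

Lemma indep_of_freezeT Y s o (X : R -> T -> R) :
  indep_of Y s -> (forall j, j \in s -> Some j != o) ->
  (forall (u : R) (S : set R), measurable S -> F o (X u @^-1` S)) ->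
  indep_freeze P setT Y X.
Proof.
move=> iY so XF.
have := @indep_of_freeze Y s finset.set0 (fun=> setT) o X iY.
rewrite (_ : \bigcap_(i in _) _ = setT); last first.
  by rewrite -subTset => w _ i.
apply => //.
- by move=> j _; rewrite finset.in_set0.
- by move=> i; rewrite finset.in_set0.
- by rewrite finset.in_set0.
Qed.

(* For [a >= 0] the event [a < T^j_Y] is almost surely the event that the running
   maximum of [B j] up to [a] is below [Y], which is left-continuous in [Y]. *)
Lemma nested_time_indep s : uniq s -> indep_of (nested_time s) s.
Proof.
elim: s => [_ J A a _ AF|j s IH /= /andP[js us] J A a sJ AF].
  have [_|_] := ltP a t.
    have -> : [set _ : T | true] = setT by apply/seteqP; split.
    by rewrite setIT probability_setT mule1.
  have -> : [set _ : T | false] = set0 by rewrite -subset0.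
  by rewrite setI0 measure0 mule0.
set G := \bigcap_(i in _) A i.
have mG : measurable G.
  apply: fin_bigcap_measurable => // i /= iJ.
  by apply: F_measurable; exact: AF.
have [a0|a0] := ltP a 0.
  have -> : [set w | a < nested_time (j :: s) w] = setT.
    by apply/seteqP; split => // w _; exact: lt_le_trans a0 (nested_time_ge0 (j :: s) w).
  by rewrite setIT probability_setT mule1.
pose Y := nested_time s; pose M w := running_max (bm_path (B j) w) a.
pose X u w : R := \1_[set w' | M w' < u] w.
have mM : measurable_fun setT M by exact: measurable_running_max.
have mMu u : measurable [set w | M w < u].
  by rewrite -[X in measurable X]setTI; apply: measurable_fun_ltr.
have mY : measurable_fun setT Y by exact: measurable_nested_time.
have mMY : measurable [set w | M w < Y w].
  by rewrite -[X in measurable X]setTI; apply: measurable_fun_ltr.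
have XE w : X (Y w) w = \1_[set w' | M w' < Y w'] w by rewrite /X !indicE.
have XF u S : measurable S -> F (Some j) (X u @^-1` S).
  move=> mS; have aD : `[0, a] `<=` (`[0, +oo[ : set R).
    by move=> y /=; rewrite !in_itv/= andbT => /andP[].
  have mind : measurable_fun (setT : set (past (B j) `[0, +oo[)) (X u).
    by apply: measurable_indic; exact: (running_max_lt_past (B_brownian j) u aD a0).
  by have := mind measurableT S mS; rewrite setTI.
have iG : indep_freeze P G Y X.
  apply: (indep_of_freeze (IH us)) XF => //.
  - by move=> i si; apply: sJ; rewrite inE si orbT.
  - by apply: sJ; rewrite inE eqxx.
  - by move=> i si; apply: contraNN js => /eqP[<-].
have iT : indep_freeze P setT Y X.
  apply: (indep_of_freezeT (IH us)) XF.
  by move=> i si; apply: contraNN js => /eqP[<-].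
have XY H : measurable H ->
    (\int[P]_(w in H) (X (Y w) w)%:E =
     P (H `&` [set w | (a < nested_time (j :: s) w)%R]))%E.
  move=> mH.
  have mN : measurable [set w | a < nested_time (j :: s) w].
    rewrite -[X in measurable X]setTI; apply: measurable_fun_ltr => //.
    exact: measurable_nested_time.
  rewrite [in RHS]setIC -integral_indic//; apply: ae_eq_integral => //.
  - apply/measurable_EFinP; apply: measurable_funTS.
    rewrite (_ : (fun w => _) = \1_[set w' | M w' < Y w']); first exact: measurable_indic.
    by apply/funext => w; exact: XE.
  - by apply/measurable_EFinP; apply: measurable_funTS; exact: measurable_indic.
  apply: filterS (hits_ae (B_brownian j)) => w hw _; rewrite XE !indicE.
  have ltT := lt_hitting_time (@continuous_bm_path _ _ _ _ _ (B_brownian j) w)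
    (bm_path0 (B_brownian j) w) (nested_time_ge0 s w)
    (hw _ (nested_time_ge0 s w)) a0.
  congr ((_ : bool)%:R%:E); apply/idP/idP; rewrite !inE/= first_passage_timeE;
    by move/ltT.
rewrite -(XY G)// -[in RHS](setTI [set w | _]) -(XY setT)//.
apply: (@integral_freeze_indep _ _ _ _ Y X mY _ _ _ G 1) => //.
- exact: nested_time_ge0.
- by move=> u; exact: measurable_indic.
- by move=> u w; rewrite /X indicE; case: (_ \in _); rewrite ?lexx ?ler01.
- rewrite (_ : (fun w => _) = \1_[set w' | M w' < Y w']); first exact: measurable_indic.
  by apply/funext => w; exact: XE.
apply: aeW => w; apply: cvg_near_cst.
have [MY|YM] := ltP (M w) (Y w).
  near=> m; rewrite /X !indicE !mem_set//=.
  near: m; apply: (cvgr_gt (Y w)) => //; exact: grid_cvg.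
apply: nearW => m; rewrite /X !indicE !memNset//=; apply/negP; rewrite -leNgt//.
by rewrite (le_trans (ltW (grid1_lt m (Y w)))).
Unshelve. all: by end_near.
Qed.

Lemma integral_exp_nested_time s l : uniq s -> 0 < l ->
  (\int[P]_w (expR (- (l * nested_time s w)))%:E =
   (expR (- (t * stable_exponent (size s) l)))%:E)%E.
Proof.
elim: s l => [|j s IH] l us l0.
  rewrite /= stable_exponent0// integral_cst// mulrC.
  by rewrite [X in (_ * X)%E](_ : _ = 1%E) ?mule1//; exact: probability_setT.
have /= /andP[js us'] := us.
have sl0 : 0 < Num.sqrt (2 * l) by rewrite sqrtr_gt0 mulr_gt0.
rewrite stable_exponentS// -(IH _ us' sl0).
pose Y := nested_time s.
pose X (u : R) w : R := expR (- (l * hitting_time (bm_path (B j) w) (Num.max u 0))).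
pose g (u : R) : R := expR (- (Num.max u 0 * Num.sqrt (2 * l))).
have max0 (u : R) : 0 <= Num.max u 0 by rewrite le_max lexx orbT.
have Y0 w : 0 <= Y w by exact: nested_time_ge0.
transitivity (\int[P]_w (X (Y w) w)%:E)%E.
  by apply: eq_integral => w _; rewrite first_passage_timeE /X max_l.
transitivity (\int[P]_w (g (Y w))%:E)%E; last first.
  by apply: eq_integral => w _; rewrite /g max_l// mulrC.
have cmax : continuous (fun u : R => Num.max u 0).
  by move=> u; apply: continuous_max; [exact: cvg_id|exact: cvg_cst].
have cg : continuous g.
  move=> u; apply: continuous_cvg; first exact: continuous_expR.
  by apply: cvgN; apply: cvgM; [exact: cmax|exact: cvg_cst].
apply: (@integral_freeze _ _ _ _ Y X _ _ _ _ g 1) => //.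
- exact: measurable_nested_time.
- move=> u; apply: measurableT_comp => //; apply: measurableT_comp => //.
  apply: measurable_funM => //.
  exact: (measurable_bm_hitting_time (B_brownian j) (max0 u)).
- move=> u w; rewrite expR_ge0/= -expR0 ler_expR oppr_le0.
  by rewrite mulr_ge0 ?(ltW l0)// hitting_time_ge0.
- exact: continuous_measurable_fun.
- by move=> u; rewrite (integral_exp_hitting_time (B_brownian j)).
- rewrite (_ : (fun w => _) = fun w => expR (- (l * nested_time (j :: s) w))).
    apply: measurableT_comp => //; apply: measurableT_comp => //.
    by apply: measurable_funM => //; exact: measurable_nested_time.
  by apply/funext => w; rewrite nested_time_cons /X max_l.
- apply: filterS (hits_ae (B_brownian j)) => w hw; rewrite /X.
  apply: continuous_cvg; first exact: continuous_expR.
  apply: cvgN; apply: cvgM; first exact: cvg_cst.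
  rewrite [X in _ --> hitting_time _ X]max_l//.
  apply: hitting_time_left_cvg => //.
  + exact: continuous_bm_path.
  + exact: bm_path0.
  + by move=> m; exact: grid1_lt.
  + exact: grid_cvg.
- apply: aeW => w; apply: (@continuous_cvg _ _ _ \oo _ (fun m => grid 1 m (Y w)) g).
    exact: cg.
  exact: grid_cvg.
apply: (indep_of_freezeT (nested_time_indep us') (o := Some j)).
  by move=> i si; apply: contraNN js => /eqP[<-].
move=> u S mS.
have mX : measurable_fun (setT : set (past (B j) `[0, +oo[)) (X u).
  apply: measurableT_comp => //; apply: measurableT_comp => //.
  apply: measurable_funM => //.
  apply: (@measurable_hitting_time _ (past (B j) `[0, +oo[) _ (bm_path (B j))
    _ _ _ (cst (Num.max u 0))) => //.
  - by move=> w; exact: continuous_bm_path.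
  - by move=> w; exact: bm_path0.
  - move=> v v0; apply: measurable_running_max_past => //.
    by move=> y /=; rewrite !in_itv/= andbT => /andP[].
  - by move=> w; exact: max0.
by have := mX measurableT S mS; rewrite setTI.
Qed.

End iterated_time.

(** * The birth process at the iterated time *)

Lemma integral_sum_bounded d (T : measurableType d) (R : realType)
    (P : probability T R) (m n : nat) (f : nat -> T -> R) (c e : nat -> R) :
  (forall i, (m <= i < n)%N -> measurable_fun setT (f i)) ->
  (forall i w, (m <= i < n)%N -> 0 <= f i w <= 1) ->
  (forall i, (m <= i < n)%N -> (\int[P]_w (f i w)%:E = (e i)%:E)%E) ->
  (\int[P]_w (\sum_(m <= i < n) f i w * c i)%:E =
   (\sum_(m <= i < n) e i * c i)%:E)%E.
Proof.
move=> mf f01 fe.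
have intf i : (m <= i < n)%N -> P.-integrable setT (EFin \o f i).
  move=> imn; apply: (@le_integrable _ _ _ _ _ _ _ (EFin \o cst 1)) => //.
  - by apply/measurable_EFinP; exact: mf.
  - move=> w _ /=; have /andP[f0 f1] := f01 i w imn.
    by rewrite lee_fin normr1 ger0_norm.
  - exact: finite_measure_integrable_cst.
pose h i w := (if (m <= i < n)%N then f i w * c i else 0)%:E.
transitivity (\int[P]_w (\sum_(m <= i < n) h i w))%E.
  apply: eq_integral => w _; rewrite -sumEFin !big_nat.
  by apply: eq_bigr => i imn; rewrite /h imn.
have hE i : (m <= i < n)%N -> h i = (fun w => (f i w)%:E * (c i)%:E)%E.
  by move=> imn; apply/funext => w; rewrite /h imn.
rewrite integral_sum//; last first.
  move=> i; have [imn|imn] := boolP (m <= i < n)%N.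
    by rewrite hE//; apply: integrableZr => //; exact: intf.
  rewrite (_ : h i = cst 0%E); first exact: integrable0.
  by apply/funext => w; rewrite /h (negbTE imn).
rewrite -sumEFin !big_nat; apply: eq_bigr => i imn.
by rewrite hE// integralZr ?fe// ; exact: intf.
Qed.

Section birth_at_nested_time.
Context (R : realType) (d : measure_display) (T : measurableType d).
Context (P : probability T R) (lambda : nat -> R).
Context (N : R -> {RV P >-> nat}) (n : nat) (B : 'I_n -> R -> {RV P >-> R}).
Hypothesis lambda_neq : forall k l, (0 < k)%N -> (0 < l)%N -> k <> l ->
  lambda k <> lambda l.
Hypothesis N_birth : pure_birth_process P lambda N.
Hypothesis B_brownian : forall j, standard_brownian_motion P (B j).
Hypothesis NB_indep : independent_processes P N (fun j t => B j t).
Variables (t : R) (s : seq 'I_n).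
Hypotheses (t_gt0 : 0 < t) (us : uniq s).

Lemma probability_birth_nested_time k : (0 < k)%N ->
  (P [set w | N (nested_time B t s w) w = k] =
   \int[P]_w (birth_prob lambda k (nested_time B t s w))%:E)%E.
Proof.
move=> k0; pose Y := nested_time B t s.
have mY : measurable_fun setT Y by exact: measurable_nested_time.
have Y0 w : 0 <= Y w by exact: nested_time_ge0.
have max0 (u : R) : 0 <= Num.max u 0 by rewrite le_max lexx orbT.
pose X (u : R) w : R := \1_[set w' | N (Num.max u 0) w' = k] w.
pose g (u : R) : R := birth_prob lambda k (Num.max u 0).
have mNu u : measurable [set w | N (Num.max u 0) w = k].
  rewrite -[X in measurable X]setTI.
  exact: (measurable_funP (N (Num.max u 0)) measurableT [set k]).
have mX u : measurable_fun setT (X u) by exact: measurable_indic.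
have Xcvg w : X (grid 0 m (Y w)) w @[m --> \oo] --> X (Y w) w.
  apply: cvg_near_cst.
  have [e /= e0 He] := pb_right_continuous N_birth w (Y0 w).
  have ge m := grid0_ge m (Y w).
  near=> m; rewrite /X !indicE !max_l ?(le_trans _ (ge m))//.
  have [->//|gY] := eqVneq (grid 0 m (Y w)) (Y w).
  have NE : N (grid 0 m (Y w)) w = N (Y w) w.
    apply: He; last by rewrite lt_neqAle eq_sym gY ge.
    by near: m; have /cvgrPdist_lt/(_ _ e0) := @grid_cvg _ 0 (Y w).
  by congr ((_ : bool)%:R); apply/idP/idP; rewrite !inE/= NE.
have XYE : (fun w => X (Y w) w) = \1_[set w | N (Y w) w = k].
  by apply/funext => w; rewrite /X !indicE max_l.
have mXY : measurable_fun setT (fun w => X (Y w) w).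
  apply: (@measurable_fun_cvg _ _ _ _ (fun m w => X (grid 0 m (Y w)) w)) => //.
  by move=> m; exact: measurable_freeze_grid.
have mNY : measurable [set w | N (Y w) w = k].
  rewrite -[X in measurable X]setTI.
  rewrite (_ : [set w | _] = (fun w => X (Y w) w) @^-1` [set 1]).
    exact: mXY.
  apply/seteqP; split => w; rewrite XYE /= indicE.
    by move=> Nk; rewrite mem_set.
  case: (boolP (w \in _)) => [/set_mem//|_] /eqP.
  by rewrite eq_sym oner_eq0.
have cb : continuous (birth_prob lambda k).
  by move=> u; exact: is_derive_cvg (is_derive_birth_prob lambda_neq u k0).
have cmax : continuous (fun u : R => Num.max u 0).
  by move=> u; apply: continuous_max; [exact: cvg_id|exact: cvg_cst].
have cg : continuous g by move=> u; exact: continuous_comp (cmax u) (cb _).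
transitivity (\int[P]_w (X (Y w) w)%:E)%E.
  rewrite -[in LHS](setIT [set w | _]) -integral_indic//.
  by apply: eq_integral => w _; rewrite -XYE.
transitivity (\int[P]_w (g (Y w))%:E)%E; last first.
  by apply: eq_integral => w _; rewrite /g max_l.
apply: (@integral_freeze _ _ _ _ Y X mY Y0 mX _ g 0) => //.
- by move=> u w; rewrite /X indicE; case: (_ \in _); rewrite ?lexx ?ler01.
- exact: continuous_measurable_fun.
- move=> u; rewrite integral_indic// setIT.
  exact: (birth_distribution lambda_neq N_birth k0 (max0 u)).
- exact: aeW.
- apply: aeW => w; apply: (@continuous_cvg _ _ _ \oo _ (fun m => grid 0 m (Y w)) g).
    exact: cg.
  exact: grid_cvg.
apply: (indep_of_freezeT NB_indep (s := s) (o := None)) => //.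
  exact: nested_time_indep.
move=> u S mS.
have : measurable_fun (setT : set (g_sigma_algebraType
    (\bigcup_(u in `[0, +oo[) preimage_set_system setT (N u) measurable))) (X u).
  apply: measurable_indic; apply: sub_sigma_algebra.
  exists (Num.max u 0); first by rewrite /= in_itv/= max0.
  by exists [set k] => //; rewrite setTI.
by move=> /(_ measurableT S mS); rewrite setTI.
Unshelve. all: by end_near.
Qed.

End birth_at_nested_time.

Theorem theorem2p4 (R : realType) (d : measure_display) (T : measurableType d)
  (P : probability T R) (lambda : nat -> R) (N : R -> {RV P >-> nat})
  (n : nat) (B : 'I_n -> R -> {RV P >-> R})
  (lambda_gt0 : forall k, (0 < k)%N -> 0 < lambda k)
  (lambda_neq : forall k l, (0 < k)%N -> (0 < l)%N -> k <> l ->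
     lambda k <> lambda l)
  (no_explosion : (\sum_(1 <= k <oo) ((lambda k)^-1)%:E = +oo)%E)
  (N_birth : pure_birth_process P lambda N)
  (n_gt0 : (0 < n)%N)
  (B_brownian : forall j, standard_brownian_motion P (B j))
  (NB_indep : independent_processes P N (fun j t => B j t))
  (t : R) (t_gt0 : 0 < t) (k : nat) (k_gt0 : (0 < k)%N) :
  P [set w | N (iterated_first_passage_time (fun j s => B j s) t w) w = k] =
  (if k == 1%N
   then expR (- (t * lambda 1%N `^ (2 ^+ n)^-1 * 2 `^ (1 - (2 ^+ n)^-1)))
   else (\prod_(1 <= j < k) lambda j) *
        \sum_(1 <= m < k.+1)
          expR (- (t * lambda m `^ (2 ^+ n)^-1 * 2 `^ (1 - (2 ^+ n)^-1))) /
          \prod_(1 <= l < k.+1 | l != m) (lambda l - lambda m))%:E.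
Proof.
have uE : uniq (enum 'I_n) by exact: enum_uniq.
apply: etrans (probability_birth_nested_time lambda_neq N_birth B_brownian
  NB_indep t_gt0 uE k_gt0) _.
set Y := nested_time B t (enum 'I_n).
have mY : measurable_fun setT Y by exact: measurable_nested_time.
have Y0 w : 0 <= Y w by exact: nested_time_ge0.
pose e m := expR (- (t * lambda m `^ (2 ^+ n)^-1 * 2 `^ (1 - (2 ^+ n)^-1))).
have mexp m : measurable_fun setT (fun w => expR (- (lambda m * Y w))).
  apply: measurableT_comp => //; apply: measurableT_comp => //.
  exact: measurable_funM.
transitivity ((\prod_(1 <= j < k) lambda j) *
    \sum_(1 <= m < k.+1) e m * birth_weight lambda k m)%:E; last first.
  have [->|//] := eqVneq k 1%N.
  by rewrite big_geq// mul1r big_nat1 /birth_weight big_mkcond big_nat1 eqxx invr1 mulr1.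
pose c m := (\prod_(1 <= j < k) lambda j) * birth_weight lambda k m.
have sumE (x : nat -> R) : (\prod_(1 <= j < k) lambda j) *
    (\sum_(1 <= m < k.+1) x m * birth_weight lambda k m) =
    \sum_(1 <= m < k.+1) x m * c m.
  by rewrite mulr_sumr; apply: eq_bigr => m _; rewrite /c mulrCA.
rewrite sumE; under eq_integral do rewrite /birth_prob sumE.
apply: integral_sum_bounded => i; first by move=> _; exact: mexp.
  move=> w /andP[i0 _]; rewrite expR_ge0/= -expR0 ler_expR oppr_le0.
  by rewrite mulr_ge0// ltW// lambda_gt0.
move=> /andP[i0 _].
rewrite (integral_exp_nested_time B_brownian NB_indep t_gt0 uE (lambda_gt0 _ i0)).
by rewrite /stable_exponent size_enum_ord /e mulrA.
Qed.
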